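(* Let $n\ge 1$ be an integer, $\sigma>0$, and let $\mathcal{C}_n$ be a finite collection of closed sub-intervals of $[0,1]$. Let $\mathcal{D}$ be the set of (integrable) non-increasing functions from $[0,1]$ to $\mathbb{R}$. For every $\alpha\in(0,1)$, $$\sup_{f\in\mathcal{D}}\mathbb{P}_f\Bigl[\max_{I\in\mathcal{C}_n}S_n^I>s_{\alpha,n}\Bigr]=\alpha .$$ Moreover, the supremum over $f\in\mathcal{D}$ of $\mathbb{P}_f\bigl[\max_{I\in\mathcal{C}_n}S_n^I>s_{\alpha,n}\bigr]$ is achieved at $f\equiv c$ on $[0,1]$ for any fixed $c\in\mathbb{R}$.
   Context: White noise model: for an integer $n\ge1$, a known $\sigma>0$ and an unknown integrable function $f:[0,1]\to\mathbb{R}$, one observes the process $$F_n(t)=\int_0^t f(x)\,dx+\frac{\sigma}{\sqrt n}W(t),\qquad t\in[0,1],$$ where $W$ is a standard Brownian motion on $[0,1]$ starting at $0$. $\mathbb{P}_f$ denotes probability when the unknown function is $f$. For a continuous function $G:[0,1]\to\mathbb{R}$ and a closed sub-interval $I\subset[0,1]$ (of positive length), $\hat G^I$ denotes the least concave majorant of the restriction of $G$ to $I$; $|I|$ is the length of $I$. The test statistic on $I$ is $$S_n^I=\sqrt{\frac{n}{\sigma^2|I|}}\,\sup_{t\in I}\bigl(\hat F_n^I(t)-F_n(t)\bigr).$$ The threshold $s_{\alpha,n}$ is the $(1-\alpha)$-quantile of the random variable $\max_{I\in\mathcal{C}_n}\frac{1}{\sqrt{|I|}}\sup_{t\in I}\bigl(\hat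 W^I(t)-W(t)\bigr)$. *)

(* Defs.v *)
From HB Require Import structures.
From mathcomp Require Export all_boot all_order all_algebra finmap.
From mathcomp Require Export all_classical all_reals all_analysis.

Set Implicit Arguments.
Unset Strict Implicit.
Unset Printing Implicit Defensive.

Import Order.TTheory GRing.Theory Num.Theory.
Import numFieldNormedType.Exports.

Local Open Scope classical_set_scope.
Local Open Scope ring_scope.

Definition mutually_independent d (T : measurableType d) (R : realType)
    (P : probability T R) (k : nat) (X : 'I_k -> T -> R) : Prop :=
  forall (J : {set 'I_k}) (A : 'I_k -> set R), (forall i, measurable (A i)) ->
    P (\bigcap_(i in [set` J]) (X i @^-1` A i)) =
    (\prod_(i in J) P (X i @^-1` A i))%E.

(* A process is indexed by all of R, but only its values on [0, 1] matter.
   The second parameter of normal_prob is the standard deviation. *)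
Record standard_brownian_motion d (T : measurableType d) (R : realType)
    (P : probability T R) (W : R -> T -> R) : Prop := {
  bm_measurable : forall t : R, 0 <= t <= 1 -> measurable_fun setT (W t) ;
  bm_start : forall w : T, W 0 w = 0 ;
  bm_continuous : forall w : T, {within `[0, 1], continuous (W ^~ w)} ;
  bm_gaussian : forall s t : R, 0 <= s -> s < t -> t <= 1 ->
    forall A : set R, measurable A ->
      P [set w | A (W t w - W s w)] = normal_prob 0 (Num.sqrt (t - s)) A ;
  bm_independent : forall (k : nat) (t : nat -> R),
    0 <= t 0%N -> (forall i, (i < k)%N -> t i < t i.+1) -> t k <= 1 ->
    mutually_independent P (fun (i : 'I_k) w => W (t i.+1) w - W (t i) w)
}.

(* An interval I = [a, b] is represented by the pair (a, b). *)
Definition unit_subinterval (R : realType) (I : R * R) : Prop :=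
  0 <= I.1 /\ I.1 < I.2 /\ I.2 <= 1.

Definition len (R : realType) (I : R * R) : R := I.2 - I.1.

Definition concave_on (R : realType) (I : R * R) (h : R -> R) : Prop :=
  convex_function (`[I.1, I.2] : set R^o) (fun t => - h t).

Definition concave_majorant (R : realType) (I : R * R) (G h : R -> R) : Prop :=
  concave_on I h /\ forall t, t \in `[I.1, I.2] -> G t <= h t.

(* Meaningful when G is bounded above on I, at points t of I; there it is the
   least concave majorant, by least_concave_majorantP. *)
Definition least_concave_majorant (R : realType) (I : R * R) (G : R -> R)
    (t : R) : R :=
  inf [set h t | h in concave_majorant I G].

Lemma least_concave_majorantP (R : realType) (I : R * R) (G : R -> R) (M : R) :
  (forall t, t \in `[I.1, I.2] -> G t <= M) ->
  concave_majorant I G (least_concave_majorant I G) /\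
  forall h, concave_majorant I G h ->
    forall t, t \in `[I.1, I.2] -> least_concave_majorant I G t <= h t.
Proof.
move=> GM.
have lb t : t \in `[I.1, I.2] ->
    lbound [set h t | h in concave_majorant I G] (G t).
  by move=> tI _ [h [_ hG] <-]; exact: hG.
have majM : concave_majorant I G (cst M).
  split=> // p x y _ _.
  by rewrite convmm.
have ne t : [set h t | h in concave_majorant I G] !=set0.
  by exists M; exists (cst M).
have least h : concave_majorant I G h ->
    forall t, t \in `[I.1, I.2] -> least_concave_majorant I G t <= h t.
  move=> hmaj t tI; apply: ge_inf; last by exists h.
  by exists (G t); exact: lb.
split=> //; split; last first.
  by move=> t tI; apply: lb_le_inf; [exact: ne|exact: lb].
move=> p x y xI yI.
have neg (u v : R^o) : p%:num * - u + unstable.onem p%:num * - v =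
    - (p%:num * u + unstable.onem p%:num * v) by rewrite !mulrN opprD.
rewrite !convRE neg lerN2; apply: lb_le_inf; first exact: ne.
move=> _ [h hmaj <-].
have := hmaj.1 p x y xI yI; rewrite !convRE neg lerN2.
apply: le_trans; rewrite !inE in xI yI.
have lx := least _ hmaj x xI; have ly := least _ hmaj y yI.
by apply: lerD; apply: ler_wpM2l => //; apply: unstable.onem_ge0.
Qed.

Definition majorant_gap (R : realType) (I : R * R) (G : R -> R) : R :=
  sup [set least_concave_majorant I G t - G t | t in `[I.1, I.2]].

(* The index of \big[Num.max/_] is the value at the first element, so that this
   is the genuine maximum over C as soon as C is nonempty. *)
Definition max_over (R : realType) (C : {fset (R * R)}) (f : R * R -> R) : R :=
  \big[Num.max/f (head (0, 0) C)]_(I <- C) f I.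

Definition quantile d (T : measurableType d) (R : realType)
    (P : probability T R) (X : T -> R) (p : R) : R :=
  inf [set x : R | (p%:E <= P [set w | (X w <= x)%R])%E].

(* the path of F_n when the unknown function is f and the noise path is w *)
Definition observed (R : realType) (n : nat) (sigma : R) (f w : R -> R)
    (t : R) : R :=
  \int[lebesgue_measure]_(x in `[0, t]) f x + sigma / Num.sqrt n%:R * w t.

Definition test_stat (R : realType) (n : nat) (sigma : R) (I : R * R)
    (F : R -> R) : R :=
  Num.sqrt (n%:R / (sigma ^+ 2 * len I)) * majorant_gap I F.

Definition threshold d (T : measurableType d) (R : realType)
    (P : probability T R) (W : R -> T -> R) (C : {fset (R * R)})
    (alpha : R) : R :=
  quantile P
    (fun w => max_over C
                (fun I => (Num.sqrt (len I))^-1 * majorant_gap I (W ^~ w)))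
    (1 - alpha).

Definition rejection_prob d (T : measurableType d) (R : realType)
    (P : probability T R) (W : R -> T -> R) (C : {fset (R * R)}) (n : nat)
    (sigma alpha : R) (f : R -> R) : \bar R :=
  P [set w | max_over C
               (fun I => test_stat n sigma I (observed n sigma f (W ^~ w)))
             > threshold P W C alpha].

(* Elements are functions on R; only their restrictions to [0, 1] matter. *)
Definition nonincreasing_class (R : realType) : set (R -> R) :=
  [set f | {in `[0, 1] &, forall x y : R, x <= y -> f y <= f x} /\
           lebesgue_measure.-integrable `[0, 1] (EFin \o f)].
Arguments nonincreasing_class R : clear implicits.

(* Main.v *)
Require Import Defs.
From mathcomp Require Import measurable_realfun ring lra zify.
Set Implicit Arguments.
Unset Strict Implicit.
Unset Printing Implicit Defensive.
Import Order.TTheory GRing.Theory Num.Theory.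
Import numFieldNormedType.Exports.
Local Open Scope classical_set_scope.
Local Open Scope ring_scope.

(** Write D_G(s, t, u) for the height of the chord of G over [s, u] above G at
the intermediate point t (chord_excess). For a continuous G, the gap between G
and its least concave majorant on I is the supremum of D_G over the triples of
I, or 0 if G is concave (majorant_gapP). Everything about the test statistics
follows from this formula, because D_G is linear in G.

The primitive F of a non-increasing function is concave, so D_F <= 0 and the
statistic of F + k W is at most that of k W, with equality when F is affine
(test_stat_le, test_stat_cst). Hence every rejection probability is at most the
one of a constant signal, which does not depend on the constant: it is the
probability that the maximum X of the normalised gaps of W exceeds its own
quantile. Dyadic triples suffice to compute the supremum of D_G, which makes
all the events measurable.

It remains to see that X exceeds its (1 - alpha)-quantile with probability
exactly alpha, for which X must not have an atom there (quantile_tail). As the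
collection is finite, it is enough that the gap of W on one interval I has no
atom (majorant_gap_no_atom).

- The gap is 0 only if W is concave on I. Then the increments of W from the
  midpoint of I are O(h), while a Gaussian variable of standard deviation
  sqrt h is at most K h in absolute value with a probability of order sqrt h
  (majorant_gap_le0_null).

- If the gap is x > 0, it is attained at a triple s < t < u. Choose dyadic
  numbers s < q1 < q2 < t, and let Z = W(q2) - W(q1). In all triples with
  s <= q1 and q2 <= t one has D_W = D' - lambda Z, where lambda =
  (u - t) / (u - s) and D' depends only on the path obtained from W by removing
  its increment over [q1, q2] (collapsed). That path is independent of Z. So
  the supremum of D_W over these triples, with u - t bounded below, is strictly
  decreasing in Z once the collapsed path is fixed, and it equals x only if Z
  equals a random threshold independent of Z. Since Z has a bounded density,
  this is a null event (independent_threshold_null, critical_null). The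
  possible choices of q1, q2 and of the lower bound on u - t are countable. *)

(** * Chords and least concave majorants *)
Lemma within_itv_eps (R : realType) (a b : R) (G : R -> R) (t e : R) :
  {within `[a, b], continuous G} -> a <= t <= b -> 0 < e ->
  exists2 d : R, 0 < d & forall v, a <= v <= b -> `|v - t| < d -> `|G v - G t| < e.
Proof.
move=> cG tab e0.
have tI : `[a, b]%classic t by rewrite /= in_itv.
move/subspace_continuousP: cG => /(_ t tI)/cvgrPdist_lt/(_ e e0).
rewrite near_withinE => /nbhs_ballP[d /= d0 dP].
exists d => // v vab vt; rewrite distrC; apply: (dP v).
  by rewrite /ball /= distrC.
by rewrite /= in_itv.
Qed.

Lemma within_itv_bounded (R : realType) (a b : R) (G : R -> R) :
  a <= b -> {within `[a, b], continuous G} ->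
  exists M, forall v, a <= v <= b -> `|G v| <= M.
Proof.
move=> ab cG.
have [c cab cM] := EVT_max ab cG; have [c' cab' cm] := EVT_min ab cG.
exists (`|G c| + `|G c'|) => v vab.
have vI : v \in `[a, b] by rewrite in_itv.
have := cM _ vI; have := cm _ vI.
have := ler_norm (G c); have := ler_norm (- G c'); rewrite normrN.
have := normr_ge0 (G c); have := normr_ge0 (G c').
by rewrite ler_norml; lra.
Qed.

Definition chord_excess (R : realType) (G : R -> R) (s t u : R) : R :=
  (u - t) / (u - s) * G s + (t - s) / (u - s) * G u - G t.

(** The point (t, G t + x) is above a chord exactly if the slope from it to the
right end is at most the slope from the left end to it. *)
Lemma chord_excess_le (R : realType) (G : R -> R) (s t u x : R) :
  s < t -> t < u ->
  (chord_excess G s t u <= x) =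
  ((G u - (G t + x)) / (u - t) <= ((G t + x) - G s) / (t - s)).
Proof.
move=> st tu; have su : 0 < u - s by lra.
have st' : 0 < t - s by lra.
have tu' : 0 < u - t by lra.
rewrite -[LHS]subr_ge0 -[RHS]subr_ge0.
have -> : x - chord_excess G s t u =
  ((G t + x - G s) / (t - s) - (G u - (G t + x)) / (u - t)) *
  ((t - s) * (u - t) / (u - s)).
  by rewrite /chord_excess; field; rewrite !lt0r_neq0.
by rewrite pmulr_lge0// divr_gt0// mulr_gt0.
Qed.

Section Gap.
Variables (R : realType) (I : R * R) (G : R -> R).
Hypotheses (I12 : I.1 < I.2) (cG : {within `[I.1, I.2], continuous G}).

(** Continuity at t takes care of the points near t and boundedness of the
others; the constant e is what makes a finite slope possible at t. *)
Lemma linear_growth (t e : R) : I.1 <= t <= I.2 -> 0 < e ->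
  exists2 K : R, 0 <= K &
    forall v, I.1 <= v <= I.2 -> G v <= G t + e + K * `|v - t|.
Proof.
move=> tI e0.
have [d d0 dP] := within_itv_eps cG tI e0.
have [M MP] := within_itv_bounded (ltW I12) cG.
have M0 : 0 <= M by apply: le_trans (MP t tI).
exists (2 * M / d) => [|v vI]; first by rewrite divr_ge0 ?mulr_ge0// ltW.
have [vt|vt] := ltP `|v - t| d.
  have := dP v vI vt; rewrite ltr_norml => /andP[_].
  suff : 0 <= 2 * M / d * `|v - t| by lra.
  by rewrite mulr_ge0// divr_ge0 ?mulr_ge0// ltW.
have : 2 * M <= 2 * M / d * `|v - t|.
  rewrite mulrAC ler_pdivlMr//; apply: ler_wpM2l => //; lra.
have := MP v vI; have := MP t tI; rewrite !ler_norml; lra.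
Qed.

(** A line through (t, G t + x + e) is above G if its slope lies between all the
slopes towards points on the right and all those from points on the left. The
chord bound says that the former are at most the latter, so that the supremum of
the right slopes will do. *)
Lemma affine_majorant (x t e : R) : 0 <= x -> 0 < e ->
  (forall s t u, I.1 <= s -> s < t -> t < u -> u <= I.2 ->
    chord_excess G s t u <= x) ->
  I.1 <= t <= I.2 ->
  exists m, forall v, I.1 <= v <= I.2 -> G v <= G t + x + e + m * (v - t).
Proof.
move=> x0 e0 Gx tI.
have [K K0 KP] := linear_growth tI e0.
(* - K is below all left slopes; it keeps the set nonempty when t is I.2. *)
pose right : set R :=
  [set y | y = - K \/ exists2 u, t < u <= I.2 &
            y = (G u - (G t + (x + e))) / (u - t)].
have rightK : ubound right K.
  move=> y [->|[u /andP[tu uI] ->]]; first lra.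
  rewrite ler_pdivrMr ?subr_gt0//.
  have := KP u; rewrite gtr0_norm ?subr_gt0//; lra.
have rightne : right !=set0 by exists (- K); left.
exists (sup right) => v /andP[Iv vI].
have [vt|tv|->] := ltgtP v t; last lra.
- have : sup right <= ((G t + (x + e)) - G v) / (t - v).
    apply: ge_sup => // y [->|[u /andP[tu uI] ->]].
      rewrite ler_pdivlMr ?subr_gt0//.
      have := KP v; rewrite ltr0_norm ?subr_lt0//; lra.
    rewrite -chord_excess_le//.
    by apply: (le_trans (Gx _ _ _ Iv vt tu uI)); lra.
  by rewrite ler_pdivlMr ?subr_gt0//; lra.
- have : (G v - (G t + (x + e))) / (v - t) <= sup right.
    apply: ub_le_sup; first by exists K.
    by right; exists v => //; rewrite tv.
  by rewrite ler_pdivrMr ?subr_gt0//; lra.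
Qed.

Lemma concave_on_chord (h : R -> R) (s t u : R) : concave_on I h ->
  I.1 <= s -> s < t -> t < u -> u <= I.2 -> chord_excess h s t u <= 0.
Proof.
move=> ch Is st tu uI.
have su : 0 < u - s by lra.
have p01 : 0 <= (u - t) / (u - s) <= 1.
  by rewrite divr_ge0/= ?ler_pdivrMr//; lra.
have := ch (Itv01 (andP p01).1 (andP p01).2) s u.
rewrite !convRE /= !inE /= !in_itv /= => /(_ ltac:(lra) ltac:(lra)).
set c := conv _ _ _; have -> : c = t.
  transitivity ((u - t) / (u - s) * s + unstable.onem ((u - t) / (u - s)) * u).
    by [].
  by rewrite /unstable.onem; field; rewrite lt0r_neq0.
have -> : unstable.onem ((u - t) / (u - s)) = (t - s) / (u - s).
  by rewrite /unstable.onem; field; rewrite lt0r_neq0.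
rewrite /chord_excess; lra.
Qed.

Lemma concave_on_affine (p q : R) : concave_on I (fun v => p + q * v).
Proof.
move=> k x y _ _.
suff -> (c : R) : c = k%:num * x + (1 - k%:num) * y ->
    - (p + q * c) = k%:num * - (p + q * x) + (1 - k%:num) * - (p + q * y) by [].
by move=> ->; ring.
Qed.

Lemma majorant_gap_has_sup :
  has_sup [set least_concave_majorant I G t - G t | t in `[I.1, I.2]].
Proof.
have [M MP] := within_itv_bounded (ltW I12) cG.
have GM t : t \in `[I.1, I.2] -> G t <= M.
  rewrite in_itv /= => /MP; rewrite ler_norml; lra.
have [_ least] := least_concave_majorantP GM.
split; first by eexists; exists I.1 => //=; rewrite in_itv /= lexx ltW.
exists (M + M) => _ [t tI <-].
have majM : concave_majorant I G (fun v => M + 0 * v).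
  by split; [exact: concave_on_affine|move=> v /GM; lra].
have := least _ majM t tI; move: tI; rewrite /= in_itv /= => /MP.
rewrite ler_norml; lra.
Qed.

(** From left to right, the majorant is above the ends of each chord, hence above
the chord. From right to left, an affine majorant passing at height
G t + x + e over t bounds the least one there. *)
Lemma majorant_gapP (x : R) : majorant_gap I G <= x <->
  0 <= x /\ forall s t u, I.1 <= s -> s < t -> t < u -> u <= I.2 ->
    chord_excess G s t u <= x.
Proof.
have hs := majorant_gap_has_sup.
have [M MP] := within_itv_bounded (ltW I12) cG.
have GM t : t \in `[I.1, I.2] -> G t <= M.
  rewrite in_itv /= => /MP; rewrite ler_norml; lra.
have [[cL GL] least] := least_concave_majorantP GM.
split=> [gx|[x0 Gx]].
  have gapx t : I.1 <= t <= I.2 -> least_concave_majorant I G t - G t <= x.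
    move=> tI; apply: le_trans gx; apply: ub_le_sup; first by case: hs.
    by exists t => //; rewrite /= in_itv.
  split=> [|s t u Is st tu uI].
    have II : I.1 <= I.1 <= I.2 by rewrite lexx ltW.
    apply: le_trans (gapx _ II); rewrite subr_ge0; apply: GL.
    by rewrite in_itv.
  have := concave_on_chord cL Is st tu uI.
  have := gapx t; have := GL s; have := GL u.
  rewrite !in_itv /= /chord_excess => /(_ ltac:(lra)) Gu /(_ ltac:(lra)) Gs.
  move=> /(_ ltac:(lra)) gt.
  have : (u - t) / (u - s) * G s <=
         (u - t) / (u - s) * least_concave_majorant I G s.
    by apply: ler_wpM2l => //; rewrite divr_ge0; lra.
  have : (t - s) / (u - s) * G u <=
         (t - s) / (u - s) * least_concave_majorant I G u.
    by apply: ler_wpM2l => //; rewrite divr_ge0; lra.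
  lra.
apply: ge_sup; first by case: hs.
move=> _ [t /= tI <-]; rewrite in_itv /= in tI.
rewrite lerBlDl; apply/ler_addgt0Pr => e e0.
have [m mP] := affine_majorant x0 e0 Gx tI.
have maj : concave_majorant I G (fun v => (G t + x + e - m * t) + m * v).
  split; first exact: concave_on_affine.
  by move=> v; rewrite in_itv /= => /mP; lra.
have := least _ maj t; rewrite in_itv /= => /(_ tI); lra.
Qed.

End Gap.

(** * Attained and dyadic chords *)

(** Composition with this retraction onto I turns a function that is continuous
on I into one that is continuous on the whole line. *)
Definition clamp (R : realType) (I : R * R) (t : R) : R :=
  Num.max I.1 (Num.min t I.2).

Section Clamp.
Variables (R : realType) (I : R * R).
Hypothesis I12 : I.1 < I.2.

Lemma clamp_itv (t : R) : I.1 <= clamp I t <= I.2.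
Proof. by rewrite /clamp le_max lexx ge_max (ltW I12) ge_min lexx orbT. Qed.

Lemma clamp_id (t : R) : I.1 <= t <= I.2 -> clamp I t = t.
Proof. by move=> /andP[It tI]; rewrite /clamp min_l// max_r. Qed.

Lemma clamp_contraction (t v : R) : `|clamp I v - clamp I t| <= `|v - t|.
Proof.
wlog tv : t v / t <= v.
  move=> H; have [/H//|/ltW/H] := leP t v.
  by rewrite distrC [leRHS]distrC.
rewrite [leRHS]ger0_norm ?subr_ge0// ler_norml /clamp.
by case: (leP t I.2) => ?; case: (leP v I.2) => ?; case: (leP I.1 t) => ?;
  case: (leP I.1 v) => ?; case: (leP I.1 I.2) => ?; lra.
Qed.

Lemma continuous_clamp (G : R -> R) : {within `[I.1, I.2], continuous G} ->
  continuous (G \o clamp I).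
Proof.
move=> cG t; apply/cvgrPdist_lt => e e0.
have [d d0 dP] := within_itv_eps cG (clamp_itv t) e0.
apply/nbhs_ballP; exists d => // v; rewrite /ball/= => tv.
rewrite distrC; apply: dP; first exact: clamp_itv.
by apply: le_lt_trans (clamp_contraction _ _) _; rewrite distrC.
Qed.

End Clamp.

Definition dyadic (R : realType) (N i : nat) : R := i%:R / 2 ^+ N.

Lemma dyadic_refine (R : realType) (N k i : nat) :
  dyadic R (N + k) (i * 2 ^ k) = dyadic R N i.
Proof.
rewrite /dyadic natrM natrX exprD; field.
by rewrite !expf_neq0.
Qed.

Lemma dyadic_between (R : realType) (a b : R) : 0 <= a -> a < b ->
  exists N, forall k, exists i, a < dyadic R (N + k) i < b.
Proof.
move=> a0 ab; exists (Num.bound (b - a)^-1) => k.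
set N := (_ + k)%N.
have N0 : 0 < 2 ^+ N :> R by rewrite exprn_gt0.
have baN : (b - a)^-1 < 2 ^+ N.
  apply: lt_trans (archi_boundP _) _; first by rewrite invr_ge0 subr_ge0 ltW.
  rewrite -natrX ltr_nat; apply: (leq_trans (ltn_expl _ (ltnSn 1))).
  by rewrite leq_exp2l// leq_addr.
have baN1 : 1 < (b - a) * 2 ^+ N.
  by rewrite mulrC -ltr_pdivrMr ?subr_gt0// div1r.
exists (Num.truncn (a * 2 ^+ N)).+1; rewrite /dyadic.
have /andP[Nl Nu] := truncn_itv (mulr_ge0 a0 (ltW N0)).
rewrite ltr_pdivlMr// ltr_pdivrMr// Nu/=.
by rewrite -[_.+1]addn1 natrD; lra.
Qed.

Lemma pos_lower_bound3 (R : realType) (a b c : R) : 0 < a -> 0 < b -> 0 < c ->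
  exists2 d : R, 0 < d & [/\ d <= a, d <= b & d <= c].
Proof.
move=> a0 b0 c0; exists (Num.min a (Num.min b c)); first by rewrite !lt_min a0 b0.
by split; rewrite !ge_min lexx ?orbT.
Qed.

Section Density.
Variables (R : realType) (I : R * R) (G : R -> R).
Hypotheses (I0 : 0 <= I.1) (I12 : I.1 < I.2).
Hypothesis cG : {within `[I.1, I.2], continuous G}.

Lemma chord_excess_near (s t u y : R) :
  I.1 <= s -> s < t -> t < u -> u <= I.2 -> y < chord_excess G s t u ->
  exists2 d : R, 0 < d & forall s' t' u' : R, I.1 <= s' -> u' <= I.2 ->
    `|s' - s| < d -> `|t' - t| < d -> `|u' - u| < d ->
    y < chord_excess G s' t' u'.
Proof.
move=> Is st tu uI yD.
pose H := G \o clamp I.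
have cH : continuous H by exact: continuous_clamp.
have GH v : I.1 <= v <= I.2 -> G v = H v by move=> vI; rewrite /H/= clamp_id.
pose f (p : R * R * R) := chord_excess H p.1.1 p.1.2 p.2.
have f1 : continuous (fun p : R * R * R => p.1.1).
  by move=> p; apply: (@continuous_comp _ _ _ fst fst); exact: cvg_fst.
have f2 : continuous (fun p : R * R * R => p.1.2).
  by move=> p; apply: (@continuous_comp _ _ _ fst snd);
    [exact: cvg_fst|exact: cvg_snd].
have f3 : continuous (fun p : R * R * R => p.2) by move=> p; exact: cvg_snd.
have cHc (g : R * R * R -> R) : continuous g -> continuous (fun p => H (g p)).
  by move=> cg p; exact: (@continuous_comp _ _ _ g H p (cg p) (cH _)).
have cf : {for (s, t, u), continuous f}.
  have us : u - s != 0 by rewrite subr_eq0 gt_eqF//; lra.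
  have cV : {for (s, t, u), continuous (fun p : R * R * R => (p.2 - p.1.1)^-1)}.
    by apply: cvgV; [exact: us|apply: cvgB; [exact: (f3 (s, t, u))|
      exact: (f1 (s, t, u))]].
  apply: cvgB; last exact: (cHc _ f2).
  apply: cvgD; apply: cvgM.
  - by apply: cvgM => //; apply: cvgB; [exact: (f3 (_, _))|exact: (f2 (_, _))].
  - exact: (cHc _ f1).
  - by apply: cvgM => //; apply: cvgB; [exact: (f2 (_, _))|exact: (f1 (_, _))].
  - exact: (cHc _ f3).
have yf : y < f (s, t, u).
  by rewrite /f /chord_excess /= -!GH//; lra.
have yn : \forall p \near (s, t, u), y < f p by exact: cvgr_gt cf _ yf.
have /nbhs_ballP[d /= d0 dP] := yn.
have [||d' d'0 [d'd st' tu']] :=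
  @pos_lower_bound3 R d ((t - s) / 2) ((u - t) / 2) d0; [lra|lra|].
exists d' => // s' t' u' Is' u'I; rewrite !ltr_norml => sd td ud.
have -> : chord_excess G s' t' u' = f (s', t', u').
  by rewrite /f /chord_excess/= -!GH//; lra.
by apply: dP; split => /=; [split => /=|];
  rewrite /ball /= ltr_norml; lra.
Qed.

(** The three indices live on a common dyadic grid, which can be as fine as
wanted: the increments of W will be taken along one grid at a time. *)
Lemma chord_excess_dyadic (s t u y e : R) : 0 < e ->
  I.1 <= s -> s < t -> t < u -> u <= I.2 -> y < chord_excess G s t u ->
  exists N, forall n, exists i j k,
    [/\ [/\ I.1 <= dyadic R (N + n) i, dyadic R (N + n) i < dyadic R (N + n) j,
        dyadic R (N + n) j < dyadic R (N + n) k & dyadic R (N + n) k <= I.2],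
      [/\ `|dyadic R (N + n) i - s| < e, `|dyadic R (N + n) j - t| < e &
      `|dyadic R (N + n) k - u| < e] &
      y < chord_excess G (dyadic R (N + n) i) (dyadic R (N + n) j)
                         (dyadic R (N + n) k)].
Proof.
move=> e0 Is st tu uI yD.
have [d d0 dP] := chord_excess_near Is st tu uI yD.
have [||r' r'0 [r'd st' tu']] :=
  @pos_lower_bound3 R d ((t - s) / 2) ((u - t) / 2) d0; [lra|lra|].
(* s' and t' are taken to the right of s and t, and u' to the left of u, so that
   the triple stays in I when s or u is an end point. *)
have [r r0 [rr' re _]] := pos_lower_bound3 r'0 e0 ltr01.
have s0 : 0 <= s := le_trans I0 Is.
have [||Ni NiP] := @dyadic_between R s (s + r); [lra|lra|].
have [||Nj NjP] := @dyadic_between R t (t + r); [lra|lra|].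
have [||Nk NkP] := @dyadic_between R (u - r) u; [lra|lra|].
exists (Ni + Nj + Nk)%N => n.
have [i iP] := NiP (Nj + Nk + n)%N.
have [j jP] := NjP (Ni + Nk + n)%N.
have [k kP] := NkP (Ni + Nj + n)%N.
rewrite !addnA in iP; rewrite !addnA (addnC Nj) in jP.
rewrite addnCA addnA in kP.
exists i, j, k; split.
- by split; lra.
- by split; rewrite ltr_norml; lra.
- by apply: dP; rewrite ?ltr_norml; lra.
Qed.

Lemma majorant_gap_le_dyadic (x : R) : majorant_gap I G <= x <->
  0 <= x /\ forall N i j k,
    I.1 <= dyadic R N i -> dyadic R N i < dyadic R N j ->
    dyadic R N j < dyadic R N k -> dyadic R N k <= I.2 ->
    chord_excess G (dyadic R N i) (dyadic R N j) (dyadic R N k) <= x.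
Proof.
rewrite majorant_gapP//; split=> -[x0 Gx]; split=> //.
  by move=> N i j k *; exact: Gx.
move=> s t u Is st tu uI; rewrite leNgt; apply/negP => xD.
have [N NP] := chord_excess_dyadic ltr01 Is st tu uI xD.
have [i [j [k [[Ii ij jk kI] _]]]] := NP 0%N.
by rewrite ltNge Gx.
Qed.

(** In the parameters s, u and l, with t = l s + (1 - l) u, the excess is
continuous on a compact set that contains the degenerate triples. It vanishes at
those, so a positive maximum is attained at a genuine triple. *)
Lemma majorant_gap_attained : 0 < majorant_gap I G ->
  exists s t u, [/\ I.1 <= s, s < t, t < u, u <= I.2 &
                    chord_excess G s t u = majorant_gap I G].
Proof.
move=> g0.
pose H := G \o clamp I.
have cH : continuous H by exact: continuous_clamp.
have GH v : I.1 <= v <= I.2 -> G v = H v by move=> vI; rewrite /H/= clamp_id.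
pose f (p : R * R * R) :=
  p.2 * H p.1.1 + (1 - p.2) * H p.1.2 - H (p.2 * p.1.1 + (1 - p.2) * p.1.2).
have f1 : continuous (fun p : R * R * R => p.1.1).
  by move=> p; apply: (@continuous_comp _ _ _ fst fst); exact: cvg_fst.
have f2 : continuous (fun p : R * R * R => p.1.2).
  by move=> p; apply: (@continuous_comp _ _ _ fst snd);
    [exact: cvg_fst|exact: cvg_snd].
have f3 : continuous (fun p : R * R * R => p.2) by move=> p; exact: cvg_snd.
have f4 : continuous (fun p : R * R * R => 1 - p.2).
  by move=> p; apply: cvgB; [exact: cvg_cst|exact: f3].
have cHc (g : R * R * R -> R) : continuous g -> continuous (fun p => H (g p)).
  by move=> cg p; exact: (@continuous_comp _ _ _ g H p (cg p) (cH _)).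
have cf : continuous f.
  move=> p; apply: cvgB.
    by apply: cvgD; apply: cvgM;
      [exact: f3|exact: (cHc _ f1)|exact: f4|exact: (cHc _ f2)].
  apply: (cHc (fun p => p.2 * p.1.1 + (1 - p.2) * p.1.2)) => {}p.
  by apply: cvgD; apply: cvgM; [exact: f3|exact: f1|exact: f4|exact: f2].
pose K : set (R * R * R) := (`[I.1, I.2] `*` `[I.1, I.2]) `*` `[0, 1].
have cK : compact K.
  by do 2?apply: compact_setX; exact: segment_compact.
have K0 : K !=set0.
  by exists (I.1, I.1, 0); do !split; rewrite /= in_itv/= ?lexx ?ler01 ?ltW.
have [|[[a b] l]] := compact_EVT_max K0 cK (f := f).
  exact: continuous_subspaceT.
rewrite inE => -[[/= + +] +]; rewrite !in_itv /= => aI bI l01 fmax.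
have chord s t u : I.1 <= s -> s < t -> t < u -> u <= I.2 ->
    chord_excess G s t u = f (s, u, (u - t) / (u - s)).
  move=> Is st tu uI; rewrite /f/= /chord_excess.
  have us : u - s != 0 by rewrite subr_eq0 gt_eqF//; lra.
  have -> : 1 - (u - t) / (u - s) = (t - s) / (u - s) by field.
  have -> : (u - t) / (u - s) * s + (t - s) / (u - s) * u = t by field.
  by rewrite -!GH//; lra.
have gapf : majorant_gap I G <= f (a, b, l).
  apply/majorant_gapP => //; split.
    have := fmax (I.1, I.1, 0); rewrite inE /K/= !in_itv/= !lexx ler01 (ltW I12).
    move=> /(_ (conj (conj isT isT) isT)); apply: le_trans.
    by rewrite /f /= !mul0r !add0r !subr0 !mul1r subrr.
  move=> s t u Is st tu uI; rewrite chord//; apply: fmax.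
  have us : 0 < u - s by lra.
  rewrite inE; do !split; rewrite /= in_itv /= ?Is ?uI; [lra|lra|].
  by rewrite divr_ge0/= ?ler_pdivrMr//; lra.
have lefg s t u : I.1 <= s -> s < t -> t < u -> u <= I.2 ->
    chord_excess G s t u <= majorant_gap I G.
  exact: ((majorant_gapP I12 cG _).1 (lexx _)).2.
have f0 : 0 < f (a, b, l) := lt_le_trans g0 gapf.
have l0 : 0 < l.
  rewrite lt_def (andP l01).1 andbT; apply: contraTN f0 => /eqP ->.
  by rewrite /f /= !mul0r !add0r !subr0 !mul1r subrr ltxx.
have l1 : l < 1.
  rewrite lt_neqAle (andP l01).2 andbT; apply: contraTN f0 => /eqP ->.
  by rewrite /f /= subrr !mul0r !addr0 !mul1r subrr ltxx.
pose c := l * a + (1 - l) * b.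
have key s u m : I.1 <= s -> s < u -> u <= I.2 -> 0 < m -> m < 1 ->
    f (s, u, m) = f (a, b, l) ->
    exists s t u, [/\ I.1 <= s, s < t, t < u, u <= I.2 &
                    chord_excess G s t u = majorant_gap I G].
  move=> Is su uI m0 m1 fE.
  have st : s < m * s + (1 - m) * u.
    have : 0 < (1 - m) * (u - s) by rewrite mulr_gt0//; lra.
    lra.
  have tu : m * s + (1 - m) * u < u.
    have : 0 < m * (u - s) by rewrite mulr_gt0//; lra.
    lra.
  exists s, (m * s + (1 - m) * u), u; split => //.
  apply/le_anti; rewrite lefg//= chord//.
  have us : u - s != 0 by rewrite subr_eq0 gt_eqF//; lra.
  have -> : (u - (m * s + (1 - m) * u)) / (u - s) = m by field.
  by rewrite fE.
(* The compact set does not order the ends of the chord. *)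
have [ab|ba|ab] := ltgtP a b.
- by apply: (key a b l) => //; lra.
- apply: (key b a (1 - l)) => //; [lra|lra|lra|lra|].
  rewrite /f/= (_ : 1 - (1 - l) = l); last by ring.
  rewrite [(1 - l) * H b + _]addrC; congr (_ - H _); ring.
- move: f0; rewrite /f /= ab.
  rewrite (_ : l * b + (1 - l) * b = b); last by ring.
  by rewrite -mulrDl (_ : l + (1 - l) = 1) ?mul1r ?subrr ?ltxx//; ring.
Qed.

End Density.

(** * The signal and the test statistics *)
Section Primitive.
Variables (R : realType) (f : R -> R).
Hypothesis nif : nonincreasing_class R f.

Let F (t : R) := \int[lebesgue_measure]_(x in `[0, t]) f x.

Lemma primitive_increment (s t : R) : 0 <= s -> s <= t -> t <= 1 ->
  (t - s) * f t <= F t - F s <= (t - s) * f s.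
Proof.
move=> s0 st t1; case: nif => fle fint.
have F_int (D : set R) : measurable D -> D `<=` (`[0, 1]%classic : set R) ->
    lebesgue_measure.-integrable D (EFin \o f).
  by move=> mD D01; apply: integrableS fint.
have -> : F t - F s = \int[lebesgue_measure]_(x in `]s, t]) f x.
  rewrite /F Rintegral_itvB//; apply: F_int => // x.
  by rewrite /= !in_itv/= => /andP[-> /le_trans]; exact.
have icst (k : R) :
    lebesgue_measure.-integrable `]s, t]%classic (EFin \o cst k).
  apply/integrableP; split; first exact/measurable_EFinP.
  rewrite (_ : (fun x => _) = cst (`|k|%:E))//.
  rewrite integral_cst//= lebesgue_measure_itv/=.
  by case: ifP => _; rewrite ?mule0 ?ltry// -EFinB -EFinM ltry.
have int_cst (k : R) :
    \int[lebesgue_measure]_(_ in `]s, t]) k = (t - s) * k.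
  rewrite Rintegral_cst//= lebesgue_measure_itv/= lte_fin.
  case: ltP => ts; first by rewrite /= mulrC.
  have -> : t = s by apply/le_anti; rewrite ts.
  by rewrite subrr mul0r mulr0.
have st01 : (`]s, t]%classic : set R) `<=` `[0, 1].
  by move=> x; rewrite /= !in_itv/=; lra.
rewrite -!int_cst; apply/andP; split; apply: le_Rintegral => //.
- exact: (icst (f t)).
- exact: F_int.
- move=> x; rewrite /= in_itv/= => /andP[sx xt].
  by apply: fle => //; rewrite in_itv/=; apply/andP; split; lra.
- exact: F_int.
- exact: (icst (f s)).
- move=> x; rewrite /= in_itv/= => /andP[sx xt].
  by apply: fle; rewrite ?in_itv/=; try (apply/andP; split); lra.
Qed.

Lemma chord_excess_primitive (s t u : R) : 0 <= s -> s < t -> t < u -> u <= 1 ->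
  chord_excess F s t u <= 0.
Proof.
move=> s0 st tu u1; rewrite chord_excess_le// !addr0.
apply: (@le_trans _ _ (f t)).
  rewrite ler_pdivrMr ?subr_gt0// mulrC.
  by have /andP[] : (u - t) * f u <= F u - F t <= (u - t) * f t;
    [apply: primitive_increment; lra|].
rewrite ler_pdivlMr ?subr_gt0// mulrC.
by have /andP[] : (t - s) * f t <= F t - F s <= (t - s) * f s;
  [apply: primitive_increment; lra|].
Qed.

Lemma primitive_continuous : {within `[0, 1], continuous F}.
Proof.
case: (nif) => fle _.
have lip (s t : R) : 0 <= s -> s <= t -> t <= 1 ->
    `|F t - F s| <= (`|f 0| + `|f 1|) * (t - s).
  move=> s0 st t1; have := primitive_increment s0 st t1.
  have fs : f s <= `|f 0|.
    by apply: le_trans (ler_norm _); apply: fle; rewrite ?in_itv/=; lra.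
  have ft : - `|f 1| <= f t.
    apply: (@le_trans _ _ (f 1)); last by apply: fle; rewrite ?in_itv/=; lra.
    by rewrite lerNl -normrN ler_norm.
  have : (t - s) * f s <= (t - s) * `|f 0| by apply: ler_wpM2l => //; lra.
  have : (t - s) * - `|f 1| <= (t - s) * f t by apply: ler_wpM2l => //; lra.
  have : 0 <= (t - s) * `|f 0| by rewrite mulr_ge0//; lra.
  have : 0 <= (t - s) * `|f 1| by rewrite mulr_ge0//; lra.
  by rewrite ler_norml; lra.
apply/subspace_continuousP => t; rewrite /= in_itv/= => t01.
apply/cvgrPdist_lt => e e0; rewrite near_withinE.
set K := `|f 0| + `|f 1|.
have K0 : 0 < K + 1 by rewrite /K; have := normr_ge0 (f 0);
  have := normr_ge0 (f 1); lra.
apply/nbhs_ballP; exists (e / (K + 1)) => /= [|v]; first exact: divr_gt0.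
rewrite /ball /= ltr_pdivlMr// => tv; rewrite in_itv/= => v01.
apply: le_lt_trans tv.
apply: (@le_trans _ _ (K * `|t - v|)); last first.
  by rewrite mulrC; apply: ler_wpM2l => //; lra.
have [vt|/ltW {}tv] := leP v t.
  by rewrite (@ger0_norm _ (t - v)) ?subr_ge0//; apply: lip; lra.
by rewrite (distrC (F t)) (distrC t) (@ger0_norm _ (v - t)) ?subr_ge0//;
  apply: lip; lra.
Qed.

End Primitive.

Lemma nonincreasing_class_cst (R : realType) (c : R) :
  nonincreasing_class R (fun _ => c).
Proof.
split => //; apply/integrableP; split; first exact/measurable_EFinP.
rewrite (_ : (fun x => _) = cst (`|c|%:E))//.
rewrite integral_cst//= lebesgue_measure_itv/= lte_fin ltr01.
by rewrite -EFinB -EFinM ltry.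
Qed.

Lemma primitive_cst (R : realType) (c t : R) : 0 <= t ->
  \int[lebesgue_measure]_(x in `[0, t]) c = c * t.
Proof.
move=> t0; rewrite Rintegral_cst//= lebesgue_measure_itv/= lte_fin.
case: ltP => [_|t0']; first by rewrite /= subr0.
by rewrite (_ : t = 0) ?mulr0//; apply/le_anti; rewrite t0 t0'.
Qed.

Section Observed.
Variables (R : realType) (I : R * R) (w : R -> R) (k : R).
Hypotheses (hI : unit_subinterval I) (cw : {within `[0, 1], continuous w}).
Hypothesis k0 : 0 < k.

Lemma unit_subinterval_sub (t : R) : I.1 <= t <= I.2 -> 0 <= t <= 1.
Proof. by case: hI => I0 [_ I1]; lra. Qed.

Lemma continuous_unit_subinterval (g : R -> R) :
  {within `[0, 1], continuous g} -> {within `[I.1, I.2], continuous g}.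
Proof.
apply: continuous_subspaceW => t; rewrite /= !in_itv/=.
exact: unit_subinterval_sub.
Qed.

Lemma chord_excess_add (F : R -> R) (s t u : R) :
  chord_excess (fun t => F t + k * w t) s t u =
  chord_excess F s t u + k * chord_excess w s t u.
Proof. by rewrite /chord_excess; ring. Qed.

Lemma continuous_signal_noise (F : R -> R) : {within `[0, 1], continuous F} ->
  {within `[0, 1], continuous (fun t => F t + k * w t)}.
Proof.
move=> cF; apply: within_continuousD => //.
by move=> t; apply: cvgM; [exact: cvg_cst|exact: cw].
Qed.

Lemma majorant_gap_add_concave (F : R -> R) : {within `[0, 1], continuous F} ->
  (forall s t u, 0 <= s -> s < t -> t < u -> u <= 1 ->
    chord_excess F s t u <= 0) ->
  majorant_gap I (fun t => F t + k * w t) <= k * majorant_gap I w.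
Proof.
move=> cF F0; case: (hI) => I0 [I12 I1].
have cwI := continuous_unit_subinterval cw.
have cFI := continuous_unit_subinterval (continuous_signal_noise cF).
have [g0 gw] := (majorant_gapP I12 cwI _).1 (lexx _).
apply/majorant_gapP => //; split; first by rewrite mulr_ge0// ltW.
move=> s t u Is st tu uI; rewrite chord_excess_add.
have : chord_excess F s t u <= 0 by apply: F0 => //; lra.
have : k * chord_excess w s t u <= k * majorant_gap I w.
  by rewrite ler_pM2l//; exact: gw.
lra.
Qed.

Lemma majorant_gap_add_affine (c : R) (F : R -> R) :
  {within `[0, 1], continuous F} -> {in `[0, 1], forall t, F t = c * t} ->
  majorant_gap I (fun t => F t + k * w t) = k * majorant_gap I w.
Proof.
move=> cF Fc; case: (hI) => I0 [I12 I1].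
have cwI := continuous_unit_subinterval cw.
have cFI := continuous_unit_subinterval (continuous_signal_noise cF).
have F0 s t u : 0 <= s -> s < t -> t < u -> u <= 1 -> chord_excess F s t u = 0.
  move=> s0 st tu u1; rewrite /chord_excess !Fc ?in_itv/=; [|lra..].
  by field; rewrite subr_eq0 gt_eqF//; lra.
apply/le_anti; rewrite majorant_gap_add_concave//=; last first.
  by move=> *; rewrite F0.
rewrite -ler_pdivlMl//; apply/majorant_gapP => //.
have [g0 gw] := (majorant_gapP I12 cFI _).1 (lexx _).
split; first by rewrite mulr_ge0// invr_ge0 ltW.
move=> s t u Is st tu uI; rewrite ler_pdivlMl//.
by have := gw _ _ _ Is st tu uI; rewrite chord_excess_add F0 ?add0r//; lra.
Qed.

End Observed.

Section TestStat.
Variables (R : realType) (n : nat) (sigma : R) (I : R * R) (w : R -> R).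
Hypotheses (n1 : (1 <= n)%N) (s0 : 0 < sigma).
Hypotheses (hI : unit_subinterval I) (cw : {within `[0, 1], continuous w}).

Let k := sigma / Num.sqrt n%:R.

Lemma noise_level_gt0 : 0 < k.
Proof. by rewrite divr_gt0// sqrtr_gt0 ltr0n. Qed.

Lemma noise_scaling (x : R) :
  Num.sqrt (n%:R / (sigma ^+ 2 * len I)) * (k * x) = (Num.sqrt (len I))^-1 * x.
Proof.
have n0 : 0 < n%:R :> R by rewrite ltr0n.
have len0 : 0 < len I by case: hI => _ [I12 _]; rewrite /len subr_gt0.
rewrite /k sqrtrM ?ler0n// sqrtrV ?mulr_ge0 ?(ltW s0) ?(ltW len0)//.
rewrite sqrtrM ?sqr_ge0// sqrtr_sqr gtr0_norm//.
have a0 : Num.sqrt n%:R != 0 :> R by rewrite gt_eqF ?sqrtr_gt0.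
have b0 : Num.sqrt (len I) != 0 by rewrite gt_eqF ?sqrtr_gt0.
by field; rewrite a0 b0 gt_eqF.
Qed.

Lemma test_stat_le (f : R -> R) : nonincreasing_class R f ->
  test_stat n sigma I (observed n sigma f w) <=
  (Num.sqrt (len I))^-1 * majorant_gap I w.
Proof.
move=> nif; rewrite /test_stat -noise_scaling.
apply: ler_wpM2l; first exact: sqrtr_ge0.
apply: (majorant_gap_add_concave hI cw noise_level_gt0).
  exact: primitive_continuous.
exact: chord_excess_primitive.
Qed.

Lemma test_stat_cst (c : R) :
  test_stat n sigma I (observed n sigma (fun _ => c) w) =
  (Num.sqrt (len I))^-1 * majorant_gap I w.
Proof.
rewrite /test_stat -noise_scaling; congr (_ * _).
apply: (majorant_gap_add_affine (c := c) hI cw noise_level_gt0).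
  exact/primitive_continuous/nonincreasing_class_cst.
by move=> t; rewrite in_itv/= => /andP[t0 _]; rewrite primitive_cst.
Qed.

End TestStat.

(** * Maxima over a finite collection *)
Section MaxOver.
Variables (R : realType) (C : {fset (R * R)}).
Hypothesis C0 : C != fset0.

Let head_in : head (0, 0) C \in C.
Proof.
have [I] := fset0Pn _ C0.
change (I \in enum_fset C -> head (0, 0) (enum_fset C) \in enum_fset C).
by case: (enum_fset C) => //= a l _; rewrite mem_head.
Qed.

Lemma max_over_le (f : R * R -> R) (x : R) :
  (max_over C f <= x) <-> (forall I, I \in C -> f I <= x).
Proof.
rewrite /max_over; split.
  by move=> fx I IC; apply: le_trans fx; exact: le_bigmax_seq.
by move=> fx; rewrite big_seq; apply: bigmax_le => [|I IC]; exact: fx.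
Qed.

Lemma max_over_attained (f : R * R -> R) :
  exists2 I, I \in C & max_over C f = f I.
Proof.
rewrite /max_over big_seq.
apply: (big_ind (fun v => exists2 I, I \in C & v = f I)).
- by exists (head (0, 0) C).
- move=> x y [I IC ->] [J JC ->]; rewrite /Num.max.
  by case: ifP => _; [exists J|exists I].
- by move=> I IC; exists I.
Qed.

Lemma eq_max_over (f g : R * R -> R) : (forall I, I \in C -> f I = g I) ->
  max_over C f = max_over C g.
Proof.
move=> fg; apply/le_anti/andP; split; apply/max_over_le => I IC.
  by rewrite fg//; apply: (max_over_le g _).1 (lexx _) _ IC.
by rewrite -fg//; apply: (max_over_le f _).1 (lexx _) _ IC.
Qed.

End MaxOver.

(** * Independent thresholds *)
Lemma normal_prob_itv_le (R : realType) (m s a b : R) : s != 0 -> a <= b ->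
  (normal_prob m s `[a, b] <= (normal_peak s * (b - a))%:E)%E.
Proof.
move=> s0 ab; rewrite /normal_prob.
apply: (@le_trans _ _
  (\int[lebesgue_measure]_(x in `[a, b]) (cst (normal_peak s)%:E x))%E).
  apply: ge0_le_integral => //=.
  - by move=> x _; rewrite lee_fin normal_pdf_ge0.
  - by apply/measurable_EFinP; apply: measurable_funTS; exact: measurable_normal_pdf.
  - by move=> x _; rewrite lee_fin normal_pdf_ub.
rewrite integral_cst//= lebesgue_measure_itv/= lte_fin.
case: ltP => _; first by rewrite -EFinB -EFinM.
by rewrite mule0 lee_fin mulr_ge0 ?normal_peak_ge0// subr_ge0.
Qed.

Section Independence.
Context {R : realType} {d : measure_display} {T : measurableType d}.
Variable P : probability T R.

Lemma probE (A : set T) : measurable A -> P A = (fine (P A))%:E.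
Proof. by move=> mA; rewrite fineK// fin_num_measure. Qed.

Lemma probD (A B : set T) : measurable A -> measurable B -> B `<=` A ->
  P (A `\` B) = (P A - P B)%E.
Proof.
move=> mA mB BA; rewrite measureD//; first by rewrite (setIidr BA).
by rewrite -ge0_fin_numE// fin_num_measure.
Qed.

Lemma null_bigcup (F : (set T)^nat) : (forall n, measurable (F n)) ->
  (forall n, P (F n) = 0%E) -> P (\bigcup_n F n) = 0%E.
Proof.
move=> mF F0; apply: measure_negligible; first exact: bigcup_measurable.
apply: negligible_bigcup => n; exists (F n); split; [exact: mF|exact: F0|exact: subset_refl].
Qed.

(** Measurability is included so that these events form a lambda-system. *)
Definition independent_of (Z : T -> R) (A : set T) : Prop :=
  measurable A /\ forall B : set R, measurable B ->
    P (A `&` Z @^-1` B) = (P A * P (Z @^-1` B))%E.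

Lemma lambda_system_independent_of (Z : T -> R) : measurable_fun setT Z ->
  lambda_system setT (independent_of Z).
Proof.
move=> mZ.
have mZB (B : set R) : measurable B -> measurable (Z @^-1` B).
  by move=> mB; rewrite -[X in measurable X]setTI; exact: mZ.
split=> //.
- by split=> // B mB; rewrite setTI probability_setT mul1e.
- move=> A B BA [mA iA] [mB iB]; split; first exact: measurableD.
  move=> D mD; have mZD := mZB D mD.
  have -> : (A `\` B) `&` Z @^-1` D = (A `&` Z @^-1` D) `\` (B `&` Z @^-1` D).
    by apply/seteqP; split=> x /=; tauto.
  have mAD := measurableI _ _ mA mZD; have mBD := measurableI _ _ mB mZD.
  rewrite probD//; last by apply: setSI.
  rewrite probD// iA// iB//.
  rewrite (probE mA) (probE mB) (probE mZD).
  by rewrite -EFinB -!EFinM mulrBl.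
- move=> F ndF iF.
  have mF i : measurable (F i) by case: (iF i).
  split; first exact: bigcup_measurable.
  move=> B mB; have mZ' := mZB B mB.
  have c1 : (fun n => P (F n `&` Z @^-1` B)) @ \oo -->
      P ((\bigcup_n F n) `&` Z @^-1` B).
    rewrite setI_bigcupl; apply: nondecreasing_cvg_mu.
    - by move=> n; exact: measurableI.
    - by apply: bigcup_measurable => n _; exact: measurableI.
    - move=> m n mn; apply/subsetPset => x [Fx Bx]; split => //.
      by have /subsetPset := ndF _ _ mn; apply.
  have c2 : (fun n => P (F n) * P (Z @^-1` B))%E @ \oo -->
      (P (\bigcup_n F n) * P (Z @^-1` B))%E.
    apply: cvgeZr; first by rewrite fin_num_measure.
    by apply: nondecreasing_cvg_mu => //; exact: bigcup_measurable.
  move: c1; rewrite (_ : (fun n => P (F n `&` _)) =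
    (fun n => P (F n) * P (Z @^-1` B))%E); last first.
    by apply/funext => n; rewrite (iF n).2.
  by move=> c1; exact: cvg_unique c1 c2.
Qed.

Lemma independent_of_bigcap (Z : T -> R) (F : (set T)^nat) :
  measurable_fun setT Z -> nonincreasing_seq F ->
  (forall n, independent_of Z (F n)) -> independent_of Z (\bigcap_n F n).
Proof.
move=> mZ niF iF; have [_ iT iD iU] := lambda_system_independent_of mZ.
rewrite -[\bigcap_n F n]setCK -setTD setC_bigcap; apply: (iD _ _ _ iT) => //.
apply: iU => [m n mn|n]; last by rewrite -setTD; apply: (iD _ _ _ iT).
by apply/subsetPset; apply: subsetC; apply/subsetPset; exact: niF.
Qed.

(** On E the value of Z is the random threshold sup {c | U c}, which is
independent of Z. Cut a bounded slab of values of Z into cells of width h. If Z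
lies in [c, c + h[ on E, then U c holds and U (c + h) does not. This has
conditional probability at most K h given U c `\` U (c + h), and these
differences are disjoint when c runs over the cells, so that the slab has
probability at most K h. *)
Lemma independent_threshold_null (Z : T -> R) (K : R) (U : R -> set T)
    (E : set T) :
  measurable_fun setT Z -> measurable E -> 0 <= K ->
  (forall c e : R, 0 < e -> (P (Z @^-1` `[c, (c + e)%R[) <= (K * e)%:E)%E) ->
  (forall c, independent_of Z (U c)) ->
  (forall c c', c <= c' -> U c' `<=` U c) ->
  (forall w c, E w -> c <= Z w -> U c w) ->
  (forall w c, E w -> Z w < c -> ~ U c w) ->
  P E = 0%E.
Proof.
move=> mZ mE K0 ZK iU Udec EU EnU.
have mZB (B : set R) : measurable B -> measurable (Z @^-1` B).
  by move=> mB; rewrite -[X in measurable X]setTI; exact: mZ.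
have mU c : measurable (U c) by case: (iU c).
pose q A := fine (P A).
have Pq A : measurable A -> P A = (q A)%:E by exact: probE.
have q0 A : 0 <= q A by rewrite fine_ge0.
have q1 A : measurable A -> q A <= 1.
  by move=> mA; rewrite -lee_fin -Pq// probability_le1.
have cell (a h : R) k : 0 < h -> q (E `&` Z @^-1` `[a, a + h *+ k[) <=
    K * h * (q (U a) - q (U (a + h *+ k))).
  move=> h0; elim: k => [|k IH].
    by rewrite mulr0n addr0 subrr mulr0 set_itvco0 preimage_set0 setI0 /q measure0.
  set c := a + h *+ k; rewrite -/c in IH.
  have cE : a + h *+ k.+1 = c + h by rewrite mulrSr addrA.
  rewrite cE.
  have split_cell : E `&` Z @^-1` `[a, c + h[ `<=`
      (E `&` Z @^-1` `[a, c[) `|`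
      ((U c `\` U (c + h)) `&` Z @^-1` `[c, c + h[).
    move=> w [Ew]; rewrite /= !in_itv/= => /andP[aZ Zc].
    have [cZ|Zc'] := leP c (Z w); [right|left].
      by split=> //; split; [exact: EU|exact: EnU].
    by split => //; rewrite aZ.
  have [_ _ iD _] := lambda_system_independent_of mZ.
  have [mUD iUD] : independent_of Z (U c `\` U (c + h)).
    by apply: iD => //; apply: Udec; rewrite lerDl ltW.
  have m1 : measurable (E `&` Z @^-1` `[a, c[).
    by apply: measurableI => //; exact: mZB.
  have m2 : measurable ((U c `\` U (c + h)) `&` Z @^-1` `[c, c + h[).
    by apply: measurableI => //; exact: mZB.
  have le2 : q (E `&` Z @^-1` `[a, c + h[) <=
      q (E `&` Z @^-1` `[a, c[) +
      q ((U c `\` U (c + h)) `&` Z @^-1` `[c, c + h[).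
    rewrite -lee_fin EFinD -!Pq//; last first.
      by apply: measurableI => //; exact: mZB.
    apply: le_trans (measureU2 _ _ _) => //.
    apply: le_measure => //; rewrite inE; last exact: measurableU.
    by apply: measurableI => //; exact: mZB.
  have qD : q (U c `\` U (c + h)) = q (U c) - q (U (c + h)).
    apply/EFin_inj; rewrite -Pq// probD//; first by rewrite !Pq.
    by apply: Udec; rewrite lerDl ltW.
  have qI : q ((U c `\` U (c + h)) `&` Z @^-1` `[c, c + h[) <=
      (q (U c) - q (U (c + h))) * (K * h).
    rewrite -qD -lee_fin EFinM -!Pq// iUD//.
    by apply: lee_wpmul2l => //; exact: ZK.
  lra.
have slab (a D : R) : 0 < D -> P (E `&` Z @^-1` `[a, a + D[) = 0%E.
  move=> D0; have mS : measurable (E `&` Z @^-1` `[a, a + D[).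
    by apply: measurableI => //; exact: mZB.
  rewrite Pq//; congr EFin; apply/le_anti; rewrite q0 andbT.
  apply/ler_addgt0Pl => e e0; rewrite addr0.
  have KD0 : 0 <= K * D by rewrite mulr_ge0// ltW.
  pose n := (Num.truncn (K * D / e)).+1.
  have n0 : 0 < n%:R :> R by rewrite ltr0n.
  have KDn : K * (D / n%:R) <= e.
    rewrite mulrA ler_pdivrMr// (mulrC e) -ler_pdivrMr// ltW//.
    exact: truncnS_gt.
  have := cell a (D / n%:R) n (divr_gt0 D0 n0).
  have -> : D / n%:R *+ n = D by rewrite -[LHS]mulr_natr divfK ?gt_eqF.
  move=> /le_trans; apply.
  apply: le_trans KDn; apply: ler_piMr; first by rewrite mulr_ge0// divr_ge0 ?ltW.
  by have := q1 _ (mU a); have := q0 (U (a + D)); lra.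
rewrite (_ : E = \bigcup_n (E `&` Z @^-1` `[- n.+1%:R, - n.+1%:R + n.+1%:R *+ 2[)).
  apply: null_bigcup => n; last first.
    by apply: slab; rewrite mulrn_wgt0// ltr0n.
  by apply: measurableI => //; exact: mZB.
apply/seteqP; split=> [w Ew|w [n _ []//]].
exists (Num.truncn `|Z w|) => //; split => //.
rewrite /= in_itv/= mulr2n addrA addNr add0r.
by have := truncnS_gt `|Z w|; rewrite ltr_norml => /andP[/ltW -> ->].
Qed.

End Independence.

(** * Measurability *)
Section Measurability.
Context {d : measure_display} {T : measurableType d}.

Lemma measurable_exists (F : nat -> set T) : (forall n, measurable (F n)) ->
  measurable [set w | exists n, F n w].
Proof.
move=> mF; rewrite (_ : [set w | _] = \bigcup_n F n).
  exact: bigcup_measurable.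
by apply/seteqP; split=> [w [n Fw]|w [n _ Fw]]; exists n.
Qed.

Lemma measurable_forall (F : nat -> set T) : (forall n, measurable (F n)) ->
  measurable [set w | forall n, F n w].
Proof.
move=> mF; rewrite (_ : [set w | _] = \bigcap_n F n).
  by apply: bigcap_measurable => //; exists 0%N.
by apply/seteqP; split=> [w Fw n _|w Fw n]; exact: Fw.
Qed.

Lemma measurable_andp (Q : Prop) (A : set T) : (Q -> measurable A) ->
  measurable [set w | Q /\ A w].
Proof.
move=> mA; have [q|nq] := pselect Q.
  rewrite (_ : [set w | _] = A); first exact: mA.
  by apply/seteqP; split=> w /=; tauto.
rewrite (_ : [set w | _] = set0)//.
by apply/seteqP; split=> w /=; tauto.
Qed.

Lemma measurable_impp (Q : Prop) (A : set T) : (Q -> measurable A) ->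
  measurable [set w | Q -> A w].
Proof.
move=> mA; have [q|nq] := pselect Q.
  rewrite (_ : [set w | _] = A); first exact: mA.
  by apply/seteqP; split=> w /=; tauto.
rewrite (_ : [set w | _] = setT)//.
by apply/seteqP; split=> w /=; tauto.
Qed.

Lemma measurable_gtr (R : realType) (f : T -> R) (y : R) :
  measurable_fun setT f -> measurable [set w | y < f w].
Proof.
move=> mf; rewrite (_ : [set w | _] = f @^-1` `]y, +oo[).
  by rewrite -[X in measurable X]setTI; apply: mf.
by apply/seteqP; split=> w; rewrite /= in_itv/= andbT.
Qed.

Lemma measurable_ler (R : realType) (f : T -> R) (y : R) :
  measurable_fun setT f -> measurable [set w | f w <= y].
Proof.
move=> mf; rewrite (_ : [set w | _] = f @^-1` `]-oo, y]).
  by rewrite -[X in measurable X]setTI; apply: mf.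
by apply/seteqP; split=> w; rewrite /= in_itv/=.
Qed.

Lemma measurable_chord_excess (R : realType) (V : R -> T -> R) (s t u : R) :
  measurable_fun setT (V s) -> measurable_fun setT (V t) ->
  measurable_fun setT (V u) ->
  measurable_fun setT (fun w => chord_excess (V ^~ w) s t u).
Proof.
move=> ms mt mu; rewrite /chord_excess.
by apply: measurable_funB => //; apply: measurable_funD; exact: measurable_funM.
Qed.

(** Reduces statements on level sets to the distribution function. *)
Lemma level_setE (R : realType) (X : T -> R) (x : R) :
  [set w | X w = x] =
  [set w | X w <= x] `\` \bigcup_l [set w | X w <= x - l.+1%:R^-1].
Proof.
apply/seteqP; split=> w /=.
  move=> Xx; rewrite Xx; split => // -[l _ /=]; rewrite Xx lerBrDr gerDl leNgt.
  by rewrite invr_gt0 ltr0n.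
move=> [Xx nl]; apply/le_anti; rewrite Xx/= leNgt; apply/negP => Xltx.
apply: nl; exists (Num.truncn (x - X w)^-1) => //=.
rewrite lerBrDr -lerBrDl ltW// invf_plt ?posrE ?subr_gt0//.
exact: truncnS_gt.
Qed.

Lemma measurable_level_set (R : realType) (X : T -> R) (x : R) :
  (forall y, measurable [set w | X w <= y]) -> measurable [set w | X w = x].
Proof.
move=> mX; rewrite level_setE; apply: measurableD => //.
exact: bigcup_measurable.
Qed.

End Measurability.

(** * One increment against the others *)
Section Others.
Context {R : realType} {d : measure_display} {T : measurableType d}.
Variables (P : probability T R) (k : nat) (X : 'I_k -> T -> R) (i0 : 'I_k).
Hypothesis mX : forall i, measurable_fun setT (X i).

(** Rectangles in all the variables but X i0; they are a pi-system generating
the sigma-algebra of these variables. *)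
Definition others : set (set T) :=
  [set A | exists B : 'I_k -> set R, (forall i, measurable (B i)) /\
    A = \bigcap_(i in [set` [set~ i0]%SET]) (X i @^-1` B i)].

Lemma setI_closed_others : setI_closed others.
Proof.
move=> A A' [B [mB ->]] [B' [mB' ->]].
exists (fun i => B i `&` B' i); split; first by move=> i; exact: measurableI.
apply/seteqP; split=> w.
  by move=> [Bw B'w] i ii0; split; [exact: Bw|exact: B'w].
by move=> BB'w; split=> i ii0; have [] := BB'w i ii0.
Qed.

Lemma others_independent_of : mutually_independent P X ->
  <<s others >> `<=` independent_of P (X i0).
Proof.
move=> indX; apply: lambda_system_subset => //.
- exact: setI_closed_others.
- exact: lambda_system_independent_of.
move=> _ [B [mB ->]]; split.
  apply: fin_bigcap_measurable => // i _.
  by rewrite -[X in measurable X]setTI; exact: mX.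
move=> C mC; rewrite (indX [set~ i0]%SET B mB).
pose B' i := if i == i0 then C else B i.
have mB' i : measurable (B' i) by rewrite /B'; case: ifP.
have -> : (\bigcap_(i in [set` [set~ i0]%SET]) (X i @^-1` B i)) `&` X i0 @^-1` C =
    \bigcap_(i in [set` [set: 'I_k]%SET]) (X i @^-1` B' i).
  apply/seteqP; split=> w.
    move=> [Bw Cw] i _; rewrite /B' /=; case: eqVneq => [->//|ii0].
    by apply: Bw; rewrite /= !inE.
  move=> B'w; split=> [i|]; last by have := B'w i0; rewrite /B'/= eqxx; apply; rewrite !inE.
  by rewrite /= !inE => ii0; have := B'w i; rewrite /B'/= (negbTE ii0); apply; rewrite !inE.
rewrite (indX [set: 'I_k]%SET B' mB') (bigD1 i0) ?inE//= muleC; congr (_ * _)%E.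
  by apply: eq_big => i; [rewrite !inE|rewrite !inE /B' => /negbTE ->].
by rewrite /B' eqxx.
Qed.

Lemma measurable_others (i : 'I_k) : i != i0 ->
  @measurable_fun _ _ (g_sigma_algebraType others) R setT (X i).
Proof.
move=> ii0 _ B mB; rewrite setTI; apply: sub_sigma_algebra.
exists (fun j => if j == i then B else setT); split.
  by move=> j; case: ifP.
apply/seteqP; split=> w.
  by move=> Bw j _ /=; case: eqVneq => [->|].
by move=> /(_ i); rewrite /= eqxx !inE; exact.
Qed.

End Others.

Lemma ler_dyadic (R : realType) (N i j : nat) :
  (dyadic R N i <= dyadic R N j) = (i <= j)%N.
Proof. by rewrite /dyadic ler_pM2r ?invr_gt0 ?exprn_gt0// ler_nat. Qed.

Lemma ltr_dyadic (R : realType) (N i j : nat) :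
  (dyadic R N i < dyadic R N j) = (i < j)%N.
Proof. by rewrite ltNge ler_dyadic -ltnNge. Qed.

Lemma dyadic0 (R : realType) (N : nat) : dyadic R N 0 = 0.
Proof. by rewrite /dyadic mul0r. Qed.

Lemma dyadic1 (R : realType) (N : nat) : dyadic R N (2 ^ N) = 1.
Proof. by rewrite /dyadic natrX divff// expf_neq0. Qed.

Lemma dyadic_ge0 (R : realType) (N i : nat) : 0 <= dyadic R N i.
Proof. by rewrite -(dyadic0 R N) ler_dyadic. Qed.

(** The path W with its increment over [q1, q2] removed; it is meant for r
outside ]q1, q2[. *)
Definition collapsed (R : realType) (T : Type) (W : R -> T -> R) (q1 q2 r : R)
    (w : T) : R :=
  W r w - (if r <= q1 then 0 else W q2 w - W q1 w).

Lemma chord_excess_collapsed (R : realType) (T : Type) (W : R -> T -> R)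
    (q1 q2 s t u : R) (w : T) : s <= q1 -> q1 < q2 -> q2 <= t -> t < u ->
  chord_excess (W ^~ w) s t u = chord_excess (collapsed W q1 q2 ^~ w) s t u -
    (u - t) / (u - s) * (W q2 w - W q1 w).
Proof.
move=> sq1 q12 q2t tu; rewrite /chord_excess /collapsed sq1.
rewrite [t <= q1]leNgt [u <= q1]leNgt.
have -> : q1 < t by lra.
have -> : q1 < u by lra.
rewrite /=.
by field; rewrite subr_eq0 gt_eqF//; lra.
Qed.

Section Brownian.
Context {R : realType} {d : measure_display} {T : measurableType d}.
Variables (P : probability T R) (W : R -> T -> R).
Hypothesis hW : standard_brownian_motion P W.

Lemma measurable_increment (q1 q2 : R) : 0 <= q1 <= 1 -> 0 <= q2 <= 1 ->
  measurable_fun setT (fun w => W q2 w - W q1 w).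
Proof.
by move=> q1I q2I; apply: measurable_funB; exact: (bm_measurable hW).
Qed.

(** Consider the grid of level N without its points strictly between q1 and q2.
One of its increments is W q2 - W q1, and at its points the collapsed path is a
sum of the others. *)
Lemma collapsed_independent (N p p' : nat) : (p < p')%N -> (p' <= 2 ^ N)%N ->
  exists2 S : set (set T),
    <<s S >> `<=`
      independent_of P (fun w => W (dyadic R N p') w - W (dyadic R N p) w) &
    forall i, (i <= p)%N \/ (p' <= i <= 2 ^ N)%N ->
      @measurable_fun _ _ (g_sigma_algebraType S) R setT
        (collapsed W (dyadic R N p) (dyadic R N p') (dyadic R N i)).
Proof.
move=> pp' p'N; pose gap := (p' - p.+1)%N.
(* The point of index i of the reduced grid; it skips p + 1, ..., p' - 1. *)
pose idx i := if (i <= p)%N then i else (i + gap)%N.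
pose tau i := dyadic R N (idx i).
pose k := (2 ^ N - gap)%N.
have pk : (p < k)%N by rewrite /k /gap; lia.
have idx_lt i : (idx i < idx i.+1)%N by rewrite /idx; case: (leqP i p) => ?;
  case: (leqP i.+1 p) => ?; lia.
have idx_k : idx k = (2 ^ N)%N by rewrite /idx leqNgt pk /k /gap /=; lia.
have tau0 : tau 0%N = 0 by rewrite /tau /idx/= dyadic0.
have tauk : tau k = 1 by rewrite /tau idx_k dyadic1.
have tau_lt i : tau i < tau i.+1 by rewrite /tau ltr_dyadic.
have taup : tau p = dyadic R N p by rewrite /tau /idx leqnn.
have taup1 : tau p.+1 = dyadic R N p'.
  by rewrite /tau /idx ltnn /gap; congr dyadic; lia.
have tau_le i j : (i <= j)%N -> tau i <= tau j.
  elim: j => [|j IH]; first by rewrite leqn0 => /eqP ->.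
  rewrite leq_eqVlt => /predU1P[->//|]; rewrite ltnS => /IH /le_trans; apply.
  exact: ltW.
have tau01 i : (i <= k)%N -> 0 <= tau i <= 1.
  by move=> ik; rewrite -tau0 -tauk !tau_le.
pose X (i : 'I_k) w := W (tau i.+1) w - W (tau i) w.
pose i0 := Ordinal pk.
have mX i : measurable_fun setT (X i).
  by apply: measurable_increment; apply: tau01 => //; exact: ltnW.
have indX : mutually_independent P X.
  by apply: (bm_independent hW); rewrite ?tau0 ?tauk.
exists (others X i0).
  have := others_independent_of (i0 := i0) mX indX.
  by rewrite /X /= taup taup1.
have mV i : (i <= k)%N ->
    @measurable_fun _ _ (g_sigma_algebraType (others X i0)) R setT
      (collapsed W (dyadic R N p) (dyadic R N p') (tau i)).
  elim: i => [_|i IH ik].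
    rewrite (_ : collapsed _ _ _ _ = cst 0); first exact: measurable_cst.
    apply/funext => w; rewrite /collapsed tau0 dyadic_ge0 (bm_start hW).
    by rewrite subr0.
  have {}IH := IH (ltnW ik).
  have [ip|ip] := eqVneq i p.
    rewrite (_ : collapsed _ _ _ _ = collapsed W (dyadic R N p) (dyadic R N p') (tau i))//.
    apply/funext => w; rewrite /collapsed ip taup1 taup lexx.
    by rewrite ler_dyadic leqNgt pp' /=; ring.
  rewrite (_ : collapsed _ _ _ _ =
      (collapsed W (dyadic R N p) (dyadic R N p') (tau i) \+ X (Ordinal ik))).
    apply: measurable_funD => //; apply: measurable_others.
    by apply: contra_neq ip => /(congr1 val).
  apply/funext => w; rewrite /= /collapsed /X/= -taup.
  have -> : (tau i.+1 <= tau p) = (tau i <= tau p).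
    rewrite !ler_dyadic /idx leqnn; apply/idP/idP.
      by move/(leq_trans (ltnW (idx_lt i))).
    by case: (leqP i p); case: (leqP i.+1 p); lia.
  by case: ifP => _; ring.
move=> i [ip|/andP[p'i iN]].
  rewrite (_ : dyadic R N i = tau i); last by rewrite /tau /idx ip.
  by apply: mV; apply: leq_trans (ltnW pk).
rewrite (_ : dyadic R N i = tau (i - gap)%N).
  by apply: mV; rewrite /k; lia.
rewrite /tau /idx leqNgt (_ : (p < i - gap)%N)//=; last by rewrite /gap; lia.
by congr dyadic; rewrite /gap; lia.
Qed.

End Brownian.

(** * Levels attained by straddling chords *)
Section CriticalLevel.
Context {R : realType} {d : measure_display} {T : measurableType d}.
Variables (P : probability T R) (W : R -> T -> R).
Hypothesis hW : standard_brownian_motion P W.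
Variables (I : R * R) (M p p' : nat) (delta : R).
Hypotheses (hI : unit_subinterval I) (pp' : (p < p')%N) (p'M : (p' <= 2 ^ M)%N).
Hypothesis delta0 : 0 < delta.

Let q1 := dyadic R M p.
Let q2 := dyadic R M p'.
Let Z w := W q2 w - W q1 w.

(** The term delta bounds the weight (u - t) / (u - s) of Z from below, which
gives strict monotonicity in Z without having to attain the supremum. *)
Definition straddling (m i j k : nat) : Prop :=
  [/\ I.1 <= dyadic R (M + m) i, dyadic R (M + m) i <= q1,
      q2 <= dyadic R (M + m) j, dyadic R (M + m) j + delta <= dyadic R (M + m) k &
      dyadic R (M + m) k <= I.2].

(** The supremum of the straddling excesses is x, spelled out with countable
quantifiers for the sake of measurability. *)
Definition critical (x : R) : set T :=
  [set w | (forall m i j k, straddling m i j k ->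
      chord_excess (W ^~ w) (dyadic R (M + m) i) (dyadic R (M + m) j)
        (dyadic R (M + m) k) <= x) /\
    (forall l : nat, exists m i j k, straddling m i j k /\
      x - l.+1%:R^-1 < chord_excess (W ^~ w) (dyadic R (M + m) i)
        (dyadic R (M + m) j) (dyadic R (M + m) k))].

Let q12 : q1 < q2. Proof. by rewrite ltr_dyadic. Qed.

Let q1E m : dyadic R (M + m) (p * 2 ^ m) = q1.
Proof. exact: dyadic_refine. Qed.

Let q2E m : dyadic R (M + m) (p' * 2 ^ m) = q2.
Proof. exact: dyadic_refine. Qed.

Let q1_01 : 0 <= q1 <= 1.
Proof.
rewrite dyadic_ge0 -(dyadic1 R M) ler_dyadic; exact: leq_trans (ltnW pp') p'M.
Qed.

Let q2_01 : 0 <= q2 <= 1.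
Proof. by rewrite dyadic_ge0 -(dyadic1 R M) ler_dyadic. Qed.

Let mZ : measurable_fun setT Z.
Proof. exact: (measurable_increment hW). Qed.

Let Zcell (c e : R) : 0 < e ->
  (P (Z @^-1` `[c, (c + e)%R[) <= (normal_peak (Num.sqrt (q2 - q1)) * e)%:E)%E.
Proof.
move=> e0; have /andP[q1_0 q1_1] := q1_01; have /andP[q2_0 q2_1] := q2_01.
have s0 : Num.sqrt (q2 - q1) != 0 by rewrite gt_eqF// sqrtr_gt0 subr_gt0.
have ce : c <= c + e by lra.
apply: (@le_trans _ _ (normal_prob 0 (Num.sqrt (q2 - q1)) `[c, (c + e)%R])).
  rewrite -(bm_gaussian hW q1_0 q12 q2_1)//.
  apply: le_measure; rewrite ?inE.
  - by rewrite -[X in measurable X]setTI; apply: mZ.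
  - by rewrite -[X in measurable X]setTI; apply: mZ.
  - by move=> w; rewrite /= !in_itv/= => /andP[-> /ltW ->].
by apply: le_trans (normal_prob_itv_le 0 s0 ce) _; rewrite addrAC subrr add0r.
Qed.

Let straddling01 (m i j k : nat) : straddling m i j k ->
  [/\ dyadic R (M + m) i < dyadic R (M + m) j,
      dyadic R (M + m) j < dyadic R (M + m) k,
      0 <= dyadic R (M + m) i & dyadic R (M + m) k <= 1].
Proof.
case: hI => I0 [_ I1] [Ii iq qj jk kI].
split; [|by apply: lt_le_trans jk; rewrite ltrDl|exact: dyadic_ge0|].
  exact: le_lt_trans iq (lt_le_trans q12 qj).
exact: le_trans kI I1.
Qed.

Let slope (m i j k : nat) : R :=
  (dyadic R (M + m) k - dyadic R (M + m) j) /
  (dyadic R (M + m) k - dyadic R (M + m) i).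

Let slope_ge (m i j k : nat) : straddling m i j k -> delta <= slope m i j k.
Proof.
move=> adm; have [ij jk i0 k1] := straddling01 adm.
case: adm => Ii iq qj jkd kI; rewrite /slope ler_pdivlMr; last lra.
apply: le_trans (_ : delta <= _); last lra.
by apply: ler_piMr; [exact: ltW|lra].
Qed.

Let Dcol (m i j k : nat) (w : T) : R :=
  chord_excess (collapsed W q1 q2 ^~ w) (dyadic R (M + m) i)
    (dyadic R (M + m) j) (dyadic R (M + m) k).

Let chordE (m i j k : nat) (w : T) : straddling m i j k ->
  chord_excess (W ^~ w) (dyadic R (M + m) i) (dyadic R (M + m) j)
    (dyadic R (M + m) k) = Dcol m i j k w - slope m i j k * Z w.
Proof.
move=> adm; have [_ jk _ _] := straddling01 adm; case: adm => Ii iq qj jkd kI.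
exact: chord_excess_collapsed.
Qed.

(** Replacing Z by the constant c leaves an event of the collapsed path on one
grid, where it is independent of Z. *)
Let V (c y : R) (m : nat) : set T :=
  [set w | exists i j k, straddling m i j k /\
    y < Dcol m i j k w - slope m i j k * c].

Let V_independent (c y : R) (m : nat) : independent_of P Z (V c y m).
Proof.
have pm : (p * 2 ^ m < p' * 2 ^ m)%N by rewrite ltn_pmul2r ?expn_gt0.
have pMm : (p' * 2 ^ m <= 2 ^ (M + m))%N by rewrite expnD leq_pmul2r ?expn_gt0.
have [S Sind] := collapsed_independent hW pm pMm.
rewrite q1E q2E in Sind * => Smeas; apply: Sind.
have dyle i : dyadic R (M + m) i <= 1 -> (i <= 2 ^ (M + m))%N.
  by rewrite -(dyadic1 R (M + m)) ler_dyadic.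
suff : @measurable _ (g_sigma_algebraType S) (V c y m) by [].
apply: measurable_exists => i; apply: measurable_exists => j.
apply: measurable_exists => k.
apply: measurable_andp => adm; apply: measurable_gtr; apply: measurable_funB => //.
have [ij jk i0 k1] := straddling01 adm; case: adm => Ii iq qj jkd kI.
rewrite /Dcol; apply: measurable_chord_excess; apply: Smeas.
- by left; rewrite -(ler_dyadic R (M + m)) q1E.
- right; rewrite -(ler_dyadic R (M + m)) q2E qj/=; apply: dyle; lra.
- right; rewrite -(ler_dyadic R (M + m)) q2E dyle// andbT; lra.
Qed.

Let straddling_refine (m i j k : nat) : straddling m i j k ->
  straddling m.+1 (i * 2) (j * 2) (k * 2).
Proof.
by move=> adm; rewrite /straddling addnS -addn1 !(dyadic_refine _ _ 1).
Qed.

Let V_nd (c y : R) : nondecreasing_seq (V c y).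
Proof.
apply/nondecreasing_seqP => m; apply/subsetPset => w [i [j [k [adm yD]]]].
exists (i * 2)%N, (j * 2)%N, (k * 2)%N; split; first exact: straddling_refine.
by rewrite /Dcol /slope addnS -addn1 !(dyadic_refine _ _ 1).
Qed.

(** This is the event that c is at most the value of Z for which the supremum
over the straddling chords is x. *)
Let U (x c : R) : set T := \bigcap_l \bigcup_m V c (x - l.+1%:R^-1) m.

Let U_independent (x c : R) : independent_of P Z (U x c).
Proof.
apply: independent_of_bigcap => //.
  apply/nonincreasing_seqP => l; apply/subsetPset => w [m _ [i [j [k [adm yD]]]]].
  exists m => //; exists i, j, k; split => //; apply: le_lt_trans yD.
  by rewrite lerB// lef_pV2 ?posrE// ler_nat.
move=> l; have [_ _ _ iU] := lambda_system_independent_of P mZ.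
by apply: iU => //; exact: V_nd.
Qed.

Lemma measurable_critical (x : R) : measurable (critical x).
Proof.
have mD m i j k : straddling m i j k -> measurable_fun setT
    (fun w => chord_excess (W ^~ w) (dyadic R (M + m) i) (dyadic R (M + m) j)
        (dyadic R (M + m) k)).
  move=> adm; have [ij jk i0 k1] := straddling01 adm.
  by apply: measurable_chord_excess; apply: (bm_measurable hW); lra.
apply: measurableI.
  apply: measurable_forall => m; apply: measurable_forall => i.
  apply: measurable_forall => j; apply: measurable_forall => k.
  by apply: measurable_impp => adm; apply: measurable_ler; exact: mD.
apply: measurable_forall => l; apply: measurable_exists => m.
apply: measurable_exists => i; apply: measurable_exists => j.
apply: measurable_exists => k.
by apply: measurable_andp => adm; apply: measurable_gtr; exact: mD.
Qed.

(** The supremum over the straddling chords decreases at least at rate delta in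
Z, so that at level x the value of Z is determined by the collapsed path. *)
Lemma critical_null (x : R) : P (critical x) = 0%E.
Proof.
apply: (@independent_threshold_null _ _ _ P Z
  (normal_peak (Num.sqrt (q2 - q1))) (U x)) => //.
- exact: measurable_critical.
- exact: normal_peak_ge0.
- move=> c c' cc' w Uw l _; have [m _ [i [j [k [adm yD]]]]] := Uw l Logic.I.
  exists m => //; exists i, j, k; split => //; apply: lt_le_trans yD _.
  have sl := slope_ge adm; rewrite lerB// ler_wpM2l//.
  by apply: le_trans sl; exact: ltW.
- move=> w c [_ Ew] cZ l _; have [m [i [j [k [adm yD]]]]] := Ew l.
  exists m => //; exists i, j, k; split => //; apply: lt_le_trans yD _.
  have sl := slope_ge adm; rewrite chordE// lerB// ler_wpM2l//.
  by apply: le_trans sl; exact: ltW.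
move=> w c [Ew _] Zc Uw.
have dZ : 0 < delta * (c - Z w) by rewrite mulr_gt0// subr_gt0.
pose l := Num.truncn (delta * (c - Z w))^-1.
have ldZ : l.+1%:R^-1 < delta * (c - Z w).
  rewrite invf_plt ?posrE//; exact: truncnS_gt.
have [m _ [i [j [k [adm yD]]]]] := Uw l Logic.I.
have sl := slope_ge adm.
have := Ew _ _ _ _ adm; rewrite chordE//.
have : delta * (c - Z w) <= slope m i j k * (c - Z w).
  by rewrite ler_wpM2r// subr_ge0 ltW.
move: yD ldZ; rewrite /=; move: (Dcol m i j k w) (slope m i j k) (Z w) => D s z.
move: (l.+1%:R^-1) => e; rewrite !mulrBr; lra.
Qed.

End CriticalLevel.

(** * The law of the gap of Brownian motion *)
Section GapLaw.
Context {R : realType} {d : measure_display} {T : measurableType d}.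

Lemma measurable_majorant_gap_le (V : R -> T -> R) (I : R * R) (x : R) :
  unit_subinterval I ->
  (forall t, 0 <= t <= 1 -> measurable_fun setT (V t)) ->
  (forall w, {within `[0, 1], continuous (V ^~ w)}) ->
  measurable [set w | majorant_gap I (V ^~ w) <= x].
Proof.
move=> hI mV cV; case: (hI) => I0 [I12 I1].
have cVI w := continuous_unit_subinterval hI (cV w).
rewrite (_ : [set w | _] = [set w | 0 <= x /\ forall N i j k,
    I.1 <= dyadic R N i -> dyadic R N i < dyadic R N j ->
    dyadic R N j < dyadic R N k -> dyadic R N k <= I.2 ->
    chord_excess (V ^~ w) (dyadic R N i) (dyadic R N j) (dyadic R N k) <= x]).
  apply: measurable_andp => _.
  apply: measurable_forall => N; apply: measurable_forall => i.
  apply: measurable_forall => j; apply: measurable_forall => k.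
  apply: measurable_impp => Ii; apply: measurable_impp => ij.
  apply: measurable_impp => jk; apply: measurable_impp => kI.
  by apply: measurable_ler; apply: measurable_chord_excess; apply: mV; lra.
by apply/seteqP; split=> w /(majorant_gap_le_dyadic I0 I12 (cVI w)).
Qed.

Variables (P : probability T R) (W : R -> T -> R).
Hypothesis hW : standard_brownian_motion P W.
Variable I : R * R.
Hypothesis hI : unit_subinterval I.

Let cWI (w : T) : {within `[I.1, I.2], continuous (W ^~ w)}.
Proof. apply: continuous_unit_subinterval => //; exact: (bm_continuous hW). Qed.

Lemma measurable_gap_le (x : R) :
  measurable [set w | majorant_gap I (W ^~ w) <= x].
Proof.
apply: measurable_majorant_gap_le => //; first exact: (bm_measurable hW).
exact: (bm_continuous hW).
Qed.

Lemma small_increment_prob_le (c h K : R) : 0 <= c -> 0 < h -> c + h <= 1 ->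
  0 <= K ->
  (P [set w | (`|W (c + h) w - W c w| <= K * h)%R] <=
   (2 * K * Num.sqrt h)%:E)%E.
Proof.
move=> c0 h0 ch1 K0; have Kh0 : 0 <= K * h by rewrite mulr_ge0// ltW.
have s0 : Num.sqrt h != 0 by rewrite gt_eqF// sqrtr_gt0.
have cch : c < c + h by rewrite ltrDl.
have hE : c + h - c = h by rewrite addrAC subrr add0r.
rewrite (_ : [set w | _] =
    [set w | `[(- (K * h))%R, (K * h)%R]%classic (W (c + h)%R w - W c w)]); last first.
  by apply/seteqP; split=> w; rewrite /= in_itv/= ler_norml.
rewrite (bm_gaussian hW)// hE.
have KhKh : - (K * h) <= K * h by lra.
apply: le_trans (normal_prob_itv_le 0 s0 KhKh) _; rewrite lee_fin.
have peak : normal_peak (Num.sqrt h) <= (Num.sqrt h)^-1.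
  rewrite /normal_peak sqr_sqrtr ?(ltW h0)// lef_pV2 ?posrE ?sqrtr_gt0//.
    rewrite ler_sqrt; have := @pi_ge2 R; rewrite mulr2n => pi2; last first.
      by rewrite addr_ge0// mulr_ge0//; lra.
    have : h * 2 <= h * pi by rewrite ler_pM2l.
    lra.
  by rewrite mulrn_wgt0// mulr_gt0// pi_gt0.
apply: (le_trans (ler_wpM2r _ peak)); first lra.
rewrite (_ : K * h - - (K * h) = 2 * K * h); last by ring.
rewrite -[X in 2 * K * X](sqr_sqrtr (ltW h0)) expr2.
by rewrite le_eqVlt; apply/orP; left; apply/eqP; field.
Qed.

(** A concave path is Lipschitz at the midpoint c of I, with a constant given by
the slopes from I.1 to c and from c to I.2. The events F N bound this constant
by N and, by the density bound, have probability at most 2 N sqrt h for every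
small h. *)
Lemma majorant_gap_le0_null : P [set w | majorant_gap I (W ^~ w) <= 0] = 0%E.
Proof.
case: (hI) => I0 [I12 I1]; pose c := (I.1 + I.2) / 2.
have Ic : I.1 < c by rewrite /c; lra.
have cI : c < I.2 by rewrite /c; lra.
have c01 : 0 <= c <= 1 by lra.
have a01 : 0 <= I.1 <= 1 by lra.
have b01 : 0 <= I.2 <= 1 by lra.
pose E := [set w | majorant_gap I (W ^~ w) <= 0].
pose F (N : nat) := E `&` ([set w | `|W c w - W I.1 w| <= N%:R * (c - I.1)] `&`
                           [set w | `|W I.2 w - W c w| <= N%:R * (I.2 - c)]).
have mabs p q y : 0 <= p <= 1 -> 0 <= q <= 1 ->
    measurable [set w | `|W q w - W p w| <= y].
  move=> p01 q01; apply: measurable_ler; apply: measurableT_comp => //.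
  exact: (measurable_increment hW).
have mF N : measurable (F N).
  by apply: measurableI; [exact: measurable_gap_le|apply: measurableI; exact: mabs].
have F0 N : P (F N) = 0%E.
  apply/le_anti; rewrite measure_ge0 andbT; apply/lee_addgt0Pr => e e0.
  rewrite add0e; have N0 : 0 <= N%:R :> R by [].
  pose h0 := e / (2 * N%:R + 1).
  have h00 : 0 < h0 by rewrite divr_gt0//; lra.
  have [|||h hp [h1 h2 _]] :=
    @pos_lower_bound3 R ((I.2 - c) / 2) (h0 ^+ 2) 1; [lra|exact: exprn_gt0|by []|].
  apply: (@le_trans _ _ (P [set w | (`|W (c + h)%R w - W c w| <= N%:R * h)%R])).
    apply: le_measure; rewrite ?inE//; first by apply: mabs => //; lra.
    move=> w [/= Ew [wa wb]].
    have [_ gw] := (majorant_gapP I12 (@cWI w) 0).1 Ew.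
    have cch : c < c + h by lra.
    have chb : c + h < I.2 by lra.
    have := gw _ _ _ (lexx _) Ic cch (ltW chb).
    have := gw _ _ _ (ltW Ic) cch chb (lexx _).
    rewrite !chord_excess_le// !addr0.
    rewrite (_ : c + h - c = h); last by ring.
    set y := W (c + h) w - W c w.
    have yE : W I.2 w - W (c + h) w = (W I.2 w - W c w) - y by rewrite /y; ring.
    rewrite yE; rewrite ler_pdivlMr// mulrAC ler_pdivrMr ?subr_gt0// => lo.
    rewrite ler_pdivrMr// mulrAC ler_pdivlMr ?subr_gt0// => up.
    move: wa wb; rewrite !ler_norml => /andP[a1 a2] /andP[b1 b2].
    apply/andP; split.
      have : (- (N%:R * h)) * (I.2 - c) <= y * (I.2 - c).
        apply: (@le_trans _ _ ((W I.2 w - W c w) * h)); last lra.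
        have := ler_wpM2r (ltW hp) b1; lra.
      by rewrite ler_pM2r// subr_gt0.
    have : y * (c - I.1) <= (N%:R * h) * (c - I.1).
      apply: (le_trans up); have := ler_wpM2r (ltW hp) a2; lra.
    by rewrite ler_pM2r// subr_gt0.
  apply: (le_trans (small_increment_prob_le _ hp _ N0)); [lra|lra|].
  rewrite lee_fin.
  have sh : Num.sqrt h <= h0.
    by rewrite -(ger0_norm (ltW h00)) -sqrtr_sqr ler_wsqrtr.
  have : 2 * N%:R * Num.sqrt h <= 2 * N%:R * h0 by rewrite ler_wpM2l// mulr_ge0.
  have : h0 * (2 * N%:R + 1) = e by rewrite /h0 divfK// gt_eqF//; lra.
  lra.
rewrite -/E (_ : E = \bigcup_N F N); first exact: null_bigcup.
apply/seteqP; split=> [w Ew|w [N _ []//]].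
pose A := `|W c w - W I.1 w| / (c - I.1); pose B := `|W I.2 w - W c w| / (I.2 - c).
exists (Num.truncn (A + B)).+1 => //.
have AB := truncnS_gt (A + B).
have A0 : 0 <= A by rewrite divr_ge0 ?subr_ge0 ?(ltW Ic).
have B0 : 0 <= B by rewrite divr_ge0 ?subr_ge0 ?(ltW cI).
by split => //; split; rewrite /= -ler_pdivrMr ?subr_gt0// -?/A -?/B; lra.
Qed.

(** The strict inequalities s < q1 < q2 < t and delta < u - t leave room for the
dyadic triples close to (s, t, u) to straddle as well, and these approach the
gap. *)
Lemma majorant_gap_attained_critical (w : T) : 0 < majorant_gap I (W ^~ w) ->
  exists M p p' l, [/\ (p < p')%N, (p' <= 2 ^ M)%N &
    critical W I M p p' l.+1%:R^-1 (majorant_gap I (W ^~ w)) w].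
Proof.
case: (hI) => I0 [I12 I1] g0; set g := majorant_gap _ _.
have [s [t [u [Is st tu uI gE]]]] := majorant_gap_attained I12 (@cWI w) g0.
have [_ gw] := (majorant_gapP I12 (@cWI w) _).1 (lexx _).
have s0 : 0 <= s by apply: le_trans I0 Is.
pose m := (s + t) / 2.
have sm : s < m by rewrite /m; lra.
have mt : m < t by rewrite /m; lra.
have [A AP] := dyadic_between s0 sm.
have [B BP] := dyadic_between (le_trans s0 (ltW sm)) mt.
have [p pP] := AP B; have [p' p'P] := BP A.
rewrite [(B + A)%N]addnC in p'P.
set M := (A + B)%N in pP p'P.
have [q1 q1E] : {q | q = dyadic R M p} by exists (dyadic R M p).
have [q2 q2E] : {q | q = dyadic R M p'} by exists (dyadic R M p').
rewrite -q1E in pP; rewrite -q2E in p'P.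
pose l := Num.truncn ((u - t) / 2)^-1.
have lut : l.+1%:R^-1 < (u - t) / 2.
  have ut2 : 0 < (u - t) / 2 by lra.
  by rewrite invf_plt ?posrE//; exact: truncnS_gt.
have lp : 0 < l.+1%:R^-1 :> R by rewrite invr_gt0 ltr0n.
exists M, p, p', l; split.
- by rewrite -(ltr_dyadic R M) -q1E -q2E; lra.
- by rewrite -(ler_dyadic R M) dyadic1 -q2E; lra.
split=> [n i j k [Ii iq qj jk kI]|l'].
  apply: gw => //; last by apply: lt_le_trans jk; rewrite ltrDl.
  by apply: le_lt_trans iq (lt_le_trans _ qj); rewrite -q1E -q2E; lra.
have [e1 e10 [e1s e1t e1u]] : exists2 e : R, 0 < e &
    [/\ e <= q1 - s, e <= t - q2 & e <= (u - t) / 4].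
  by apply: pos_lower_bound3; lra.
have gl : g - l'.+1%:R^-1 < chord_excess (W ^~ w) s t u.
  by rewrite gE ltrBlDr ltrDl invr_gt0 ltr0n.
have [N NP] := chord_excess_dyadic I0 I12 (@cWI w) e10 Is st tu uI gl.
have [i [j [k [[Ii ij jk kI] [si tj uk] yD]]]] := NP M.
rewrite [(N + M)%N]addnC in Ii ij jk kI si tj uk yD.
exists N, i, j, k; split=> //.
move: si tj uk; rewrite !ltr_norml => si tj uk.
by split; rewrite -?q1E -?q2E //; move: lut; move: (l.+1%:R^-1) => y lut; lra.
Qed.

Lemma measurable_gap_eq (x : R) :
  measurable [set w | majorant_gap I (W ^~ w) = x].
Proof.
by apply: measurable_level_set => y; exact: measurable_gap_le.
Qed.

Lemma majorant_gap_no_atom (x : R) :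
  P [set w | majorant_gap I (W ^~ w) = x] = 0%E.
Proof.
have mE := measurable_gap_eq x.
apply: (measure_negligible mE).
have [x0|x0] := leP x 0.
  apply: (@negligibleS _ _ _ _ [set w | majorant_gap I (W ^~ w) <= 0]).
    by move=> w /= ->.
  apply/negligibleP; [exact: measurable_gap_le|exact: majorant_gap_le0_null].
pose F n : set T := if (choice.unpickle n : option (nat * nat * nat * nat)) is Some (M, p, p', l)
  then if (p < p')%N && (p' <= 2 ^ M)%N
       then critical W I M p p' l.+1%:R^-1 x else set0 else set0.
apply: (@negligibleS _ _ _ _ (\bigcup_n F n)).
  move=> w /= gx; have g0 : 0 < majorant_gap I (W ^~ w) by rewrite gx.
  have [M [p [p' [l [pp' p'M crit]]]]] := majorant_gap_attained_critical g0.
  exists (choice.pickle (M, p, p', l)) => //; rewrite /F choice.pickleK pp' p'M/=.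
  by rewrite gx in crit.
apply: negligible_bigcup => n; rewrite /F.
case: choice.unpickle => [[[[M p] p'] l]|]; last exact: negligible_set0.
case: ifP => [/andP[pp' p'M]|_]; last exact: negligible_set0.
have lp : 0 < l.+1%:R^-1 :> R by rewrite invr_gt0 ltr0n.
apply/negligibleP; first exact: (measurable_critical hW).
exact: (critical_null hW).
Qed.

End GapLaw.

(** * Quantiles *)
Section Quantile.
Context {R : realType} {d : measure_display} {T : measurableType d}.
Variables (P : probability T R) (X : T -> R).
Hypothesis mX : forall x, measurable [set w | X w <= x].

Let le_cdf (x y : R) : x <= y -> (P [set w | (X w <= x)%R] <= P [set w | (X w <= y)%R])%E.
Proof.
by move=> xy; apply: le_measure; rewrite ?inE// => w /= /le_trans; exact.
Qed.

Lemma cdf_cvg1 :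
  (fun n : nat => P [set w | (X w <= n%:R)%R]) @ \oo --> 1%E.
Proof.
have -> : 1%E = P (\bigcup_n [set w | (X w <= n%:R)%R]).
  rewrite (_ : \bigcup_n _ = setT) ?probability_setT//.
  apply/seteqP; split=> w // _; exists (Num.truncn (X w)).+1 => //=.
  exact/ltW/truncnS_gt.
apply: nondecreasing_cvg_mu => //; first exact: bigcup_measurable.
apply/nondecreasing_seqP => n; apply/subsetPset => w /= /le_trans; apply.
by rewrite ler_nat.
Qed.

Lemma cdf_cvg0 :
  (fun n : nat => P [set w | (X w <= - n%:R)%R]) @ \oo --> 0%E.
Proof.
have -> : 0%E = P (\bigcap_n [set w | (X w <= - n%:R)%R]).
  rewrite (_ : \bigcap_n _ = set0) ?measure0//.
  apply/seteqP; split=> w // /(_ (Num.truncn (- X w)).+1 I) /=.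
  by rewrite lerNr leNgt truncnS_gt.
apply: nonincreasing_cvg_mu => //.
- by rewrite -ge0_fin_numE// fin_num_measure.
- exact: bigcap_measurable.
apply/nonincreasing_seqP => n; apply/subsetPset => w /= /le_trans; apply.
by rewrite lerN2 ler_nat.
Qed.

Variable p : R.
Hypotheses (p0 : 0 < p) (p1 : p < 1).

Let S := [set x : R | (p%:E <= P [set w | (X w <= x)%R])%E].

Lemma quantile_has_inf : has_inf S.
Proof.
split.
  apply: contrapT => S0; have : (1 <= p%:E)%E.
    apply: (cvge_to_le cdf_cvg1); apply: nearW => n; rewrite leNgt.
    by apply/negP => /ltW pn; apply: S0; exists n%:R.
  by rewrite lee_fin leNgt p1.
have [N pN] : exists N : nat, (P [set w | (X w <= - N%:R)%R] < p%:E)%E.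
  apply: contrapT => nN; have : (p%:E <= 0)%E.
    apply: (cvge_to_ge cdf_cvg0); apply: nearW => n; rewrite leNgt.
    by apply/negP => pn; apply: nN; exists n.
  by rewrite lee_fin leNgt p0.
exists (- N%:R) => x Sx.
rewrite leNgt; apply/negP => xN; have := le_cdf (ltW xN).
by rewrite leNgt (lt_le_trans pN Sx).
Qed.

(** The distribution function is continuous from the right, so it is at least p
at q; its left limit at q is at most p, and both coincide without an atom. *)
Lemma quantile_tail : P [set w | X w = quantile P X p] = 0%E ->
  P [set w | (quantile P X p < X w)%R] = (1 - p)%:E.
Proof.
set q := quantile P X p => Xq0; have [S0 lbS] := quantile_has_inf.
have ge_p : (p%:E <= P [set w | (X w <= q)%R])%E.
  have cv : (fun l : nat => P [set w | (X w <= q + l.+1%:R^-1)%R]) @ \oo -->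
      P [set w | (X w <= q)%R].
    rewrite (_ : [set w | (X w <= q)%R] =
        \bigcap_l [set w | (X w <= q + l.+1%:R^-1)%R]).
      apply: nonincreasing_cvg_mu => //.
      - by rewrite -ge0_fin_numE// fin_num_measure.
      - exact: bigcap_measurable.
      apply/nonincreasing_seqP => n; apply/subsetPset => w /= /le_trans; apply.
      by rewrite lerD2l lef_pV2 ?posrE// ler_nat.
    apply/seteqP; split=> [w /= Xw l _ /=|w Xw /=].
      by apply: (le_trans Xw); rewrite lerDl.
    apply/ler_addgt0Pr => e e0; apply: (le_trans (Xw (Num.truncn e^-1) I)).
    rewrite lerD2l ltW// invf_plt ?posrE//; exact: truncnS_gt.
  apply: (cvge_to_ge cv); apply: nearW => l.
  have [x Sx xq] : exists2 x, S x & x < q + l.+1%:R^-1.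
    by apply: inf_adherent => //; rewrite invr_gt0.
  by apply: (le_trans Sx); exact/le_cdf/ltW.
have lt_p : (P (\bigcup_l [set w | (X w <= q - l.+1%:R^-1)%R]) <= p%:E)%E.
  have cv : (fun l : nat => P [set w | (X w <= q - l.+1%:R^-1)%R]) @ \oo -->
      P (\bigcup_l [set w | (X w <= q - l.+1%:R^-1)%R]).
    apply: nondecreasing_cvg_mu => //; first exact: bigcup_measurable.
    apply/nondecreasing_seqP => n; apply/subsetPset => w /= /le_trans; apply.
    by rewrite lerD2l lerN2 lef_pV2 ?posrE// ler_nat.
  apply: (cvge_to_le cv); apply: nearW => l.
  rewrite leNgt; apply/negP => /ltW Sq.
  have : q <= q - l.+1%:R^-1 by apply: ge_inf.
  by rewrite lerBrDr gerDl leNgt invr_gt0 ltr0n.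
have eq_p : P [set w | (X w <= q)%R] = p%:E.
  apply/le_anti; rewrite ge_p andbT; apply: le_trans lt_p.
  set A := \bigcup_l _.
  have mA : measurable A by exact: bigcup_measurable.
  have AE : [set w | X w = q] = [set w | X w <= q] `\` A by exact: level_setE.
  have mE : measurable [set w | X w = q] by rewrite AE; exact: measurableD.
  rewrite -(measureU0 mA mE Xq0) AE.
  apply: le_measure; rewrite ?inE//.
    by apply: measurableU => //; exact: measurableD.
  by move=> w Xq; have [Aw|nAw] := pselect (A w); [left|right].
rewrite (_ : [set w | _] = ~` [set w | (X w <= q)%R]).
  by rewrite probability_setC// eq_p -EFinB.
by apply/seteqP; split=> w /= Xq; [apply/negP|move/negP: Xq]; rewrite -ltNge.
Qed.

End Quantile.

(** * The multiscale test *)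
Section LocalStatistics.
Context {R : realType} {d : measure_display} {T : measurableType d}.
Variables (P : probability T R) (W : R -> T -> R).
Hypothesis hW : standard_brownian_motion P W.
Variable C : {fset (R * R)}.
Hypotheses (hC0 : C != fset0).
Hypothesis (hC : forall I : R * R, I \in C -> unit_subinterval I).

Lemma measurable_max_over_le (X : R * R -> T -> R) (x : R) :
  (forall I, I \in C -> measurable [set w | X I w <= x]) ->
  measurable [set w | max_over C (X ^~ w) <= x].
Proof.
move=> mX; rewrite (_ : [set w | _] =
    \bigcap_(I in [set` C]) [set w | X I w <= x]).
  by apply: fin_bigcap_measurable => [|I /= /mX//]; exact: finite_fset.
by apply/seteqP; split=> w /= /(max_over_le hC0).
Qed.

Let X (w : T) : R :=
  max_over C (fun I => (Num.sqrt (len I))^-1 * majorant_gap I (W ^~ w)).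

Let len_gt0 (I : R * R) : I \in C -> 0 < Num.sqrt (len I).
Proof. by move=> /hC[_ [I12 _]]; rewrite sqrtr_gt0 subr_gt0. Qed.

Lemma measurable_null_max_le (x : R) : measurable [set w | X w <= x].
Proof.
apply: measurable_max_over_le => I IC.
rewrite (_ : [set w | _] =
    [set w | majorant_gap I (W ^~ w) <= Num.sqrt (len I) * x]).
  exact: (measurable_gap_le hW (hC IC)).
by apply/seteqP; split=> w /=; rewrite ler_pdivrMl// len_gt0.
Qed.

Lemma null_max_no_atom (x : R) : P [set w | X w = x] = 0%E.
Proof.
pose E I := [set w | majorant_gap I (W ^~ w) = Num.sqrt (len I) * x].
have XE : [set w | X w = x] `<=` \bigcup_(I in [set` C]) E I.
  move=> w /= Xw; have [I IC XI] := max_over_attained hC0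
    (fun I => (Num.sqrt (len I))^-1 * majorant_gap I (W ^~ w)).
  by exists I => //; rewrite /E/= -Xw /X XI mulrA divff ?mul1r// gt_eqF// len_gt0.
apply: measure_negligible.
  by apply: measurable_level_set => y; exact: measurable_null_max_le.
pose F k := if (k < size (enum_fset C))%N then E (nth (0, 0) (enum_fset C) k)
            else set0.
apply: (@negligibleS _ _ _ _ (\bigcup_k F k)).
  move=> w /XE[I /= IC Ew]; exists (index I (enum_fset C)) => //.
  by rewrite /F index_mem IC nth_index.
apply: negligible_bigcup => k; rewrite /F.
case: ifP => [kC|_]; last exact: negligible_set0.
have IC : nth (0, 0) (enum_fset C) k \in C by exact: mem_nth.
apply/negligibleP; first exact: (measurable_gap_eq hW (hC IC)).
exact: (majorant_gap_no_atom hW (hC IC)).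
Qed.

Lemma rejection_prob_max (alpha : R) : 0 < alpha -> alpha < 1 ->
  P [set w | threshold P W C alpha < X w] = alpha%:E.
Proof.
move=> a0 a1; rewrite /threshold -/X (quantile_tail measurable_null_max_le).
- by congr EFin; ring.
- lra.
- lra.
- exact: null_max_no_atom.
Qed.

Variables (n : nat) (sigma alpha : R).
Hypotheses (hn : (1 <= n)%N) (hsigma : 0 < sigma).

Lemma rejection_prob_le (f : R -> R) : nonincreasing_class R f ->
  (rejection_prob P W C n sigma alpha f <=
   P [set w | (threshold P W C alpha < X w)%R])%E.
Proof.
move=> nif; have cW w : {within `[0, 1], continuous (W ^~ w)}.
  exact: (bm_continuous hW).
have gtC (Y : T -> R) (x : R) :
    measurable [set w | Y w <= x] -> measurable [set w | x < Y w].
  move=> mY; rewrite (_ : [set w | _] = ~` [set w | Y w <= x]).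
    exact: measurableC.
  by apply/seteqP; split=> w /= Yx; [apply/negP|move/negP: Yx]; rewrite -ltNge.
apply: le_measure; rewrite ?inE.
- apply: gtC; apply: measurable_max_over_le => I IC.
  set k := Num.sqrt (n%:R / (sigma ^+ 2 * len I)).
  have k0 : 0 < k.
    rewrite sqrtr_gt0 divr_gt0 ?ltr0n// mulr_gt0 ?exprn_gt0// -sqrtr_gt0.
    exact: len_gt0.
  rewrite (_ : [set w | _] = [set w |
      majorant_gap I (observed n sigma f (W ^~ w)) <= k^-1 * threshold P W C alpha]).
    apply: (measurable_majorant_gap_le (V := fun t w => observed n sigma f (W ^~ w) t)).
    + exact: hC.
    + move=> t t01; apply: measurable_funD => //; apply: measurable_funM => //.
      exact: (bm_measurable hW).
    + move=> w; apply: continuous_signal_noise => //.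
      exact: primitive_continuous.
  by apply/seteqP; split=> w /=; rewrite /test_stat -/k ler_pdivlMl.
- by apply: gtC; exact: measurable_null_max_le.
- move=> w /= /lt_le_trans; apply; apply/(max_over_le hC0) => I IC.
  apply: (le_trans (test_stat_le hn hsigma (hC IC) (cW w) nif)).
  by apply: (max_over_le hC0 _ _).1 (lexx _) _ IC.
Qed.

Lemma rejection_prob_cst (c : R) :
  rejection_prob P W C n sigma alpha (fun _ => c) =
  P [set w | threshold P W C alpha < X w].
Proof.
have eX w : max_over C (fun I =>
    test_stat n sigma I (observed n sigma (fun _ => c) (W ^~ w))) = X w.
  apply: (eq_max_over hC0) => I IC.
  by apply: (test_stat_cst hn hsigma (hC IC)); exact: (bm_continuous hW).
by rewrite /rejection_prob; congr (P _); apply/funext => w /=; rewrite eX.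
Qed.

End LocalStatistics.

Theorem theorem2p2 (R : realType) (d : measure_display) (T : measurableType d)
    (P : probability T R) (W : R -> T -> R)
    (hW : standard_brownian_motion P W)
    (n : nat) (hn : (1 <= n)%N) (sigma : R) (hsigma : 0 < sigma)
    (C : {fset (R * R)}) (hC0 : C != fset0)
    (hC : forall I : R * R, I \in C -> unit_subinterval I)
    (alpha : R) (halpha0 : 0 < alpha) (halpha1 : alpha < 1) :
  ereal_sup [set rejection_prob P W C n sigma alpha f
            | f in nonincreasing_class R] = alpha%:E
  /\
  forall c : R,
    nonincreasing_class R (fun _ => c) /\
    rejection_prob P W C n sigma alpha (fun _ => c) =
      ereal_sup [set rejection_prob P W C n sigma alpha f
                | f in nonincreasing_class R].
Proof.
have tail := rejection_prob_max hW hC0 hC halpha0 halpha1.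
have rej_cst (c : R) : rejection_prob P W C n sigma alpha (fun _ => c) = alpha%:E.
  by rewrite (rejection_prob_cst hW hC0 hC _ hn hsigma).
have supE : ereal_sup [set rejection_prob P W C n sigma alpha f
                      | f in nonincreasing_class R] = alpha%:E.
  apply/le_anti/andP; split.
    apply: ge_ereal_sup => _ [f nif <-]; rewrite -tail.
    exact: rejection_prob_le.
  rewrite -(rej_cst 0); apply: ereal_sup_ubound.
  by exists (fun=> 0) => //; exact: nonincreasing_class_cst.
split=> // c; split; first exact: nonincreasing_class_cst.
by rewrite supE rej_cst.
Qed.
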